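(* Let $n \in \mathbb{N}$, $n \geq 2$, be arbitrary. Let $\mathcal{POD}_{n}$ be the monoid of order-preserving or order-reversing partial transformations on $\{1,\ldots,n\}$ with the usual order, and let $\gamma_{n}$ be the permutation of degree $n$ that reverses this order. Then the maximal subsemigroups of $\mathcal{POD}_{n}$ are precisely: (a) $\mathcal{POD}_{n} \setminus \{\gamma_{n}\}$ (type (M5)); (b) the union of $\mathcal{POD}_{n} \setminus J_{n - 1}$ and the union of the sets in $$\{(L_{i} \cup L_{n - i + 1}) \cap \mathcal{POD}_{n} : i \in A\} \cup \{(R_{i} \cup R_{n - i + 1}) \cap \mathcal{POD}_{n} : i \in \{1,\ldots,\lceil n/2\rceil\},\ i \notin A\} \cup \{(R_{\{ i, i + 1 \}} \cup R_{\{n - i, n - i + 1\}}) \cap \mathcal{POD}_{n} : i\in\{1,\ldots,\lfloor n/2\rfloor\},\ i, i + 1 \notin A\},$$ where $A$ is any non-empty proper subset of $\{1, \ldots, \lceil n / 2\rceil\}$ (type (M2)); and (c) $\mathcal{POD}_{n} \setminus (R \cup \gamma_{n} R)$, where $R$ is any $\mathscr{R}$-class in $J_{n - 1} \cap \mathcal{POD}_{n}$ (type (M4)); in particular: (i) $\mathcal{POD}_{n}\setminus (R_{i}\cup R_{n - i + 1})$, for $i \in \{1, \ldots, \lceil n / 2\rceil\}$; and (ii) $\mathcal{POD}_{n}\setminus (R_{\{i, i + 1\}}\cup R_{\{n - i, n - i + 1\}})$, for $i \in \{1, \ldots, \lfloor n / 2\rfloor\}$. The monoid $\mathcal{POD}_{1}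 = \mathcal{PT}_{1}$ is a semilattice of order $2$: its maximal subsemigroups are each of its singleton subsets. In particular, for $n \in \mathbb{N}$, there are $2^{\lceil n / 2\rceil} + n - 1$ maximal subsemigroups of $\mathcal{POD}_{n}$.
   Context: $\mathbb{N}=\{1,2,3,\ldots\}$. A maximal subsemigroup of a semigroup $S$ is a proper subsemigroup not contained in any other proper subsemigroup of $S$. A semilattice is a commutative semigroup of idempotents. $\mathcal{PT}_n$ is the monoid of all partial maps from $\{1,\ldots,n\}$ to itself (partial transformations) under composition, with maps written on the right and composed left to right. For $\alpha\in\mathcal{PT}_n$, $\operatorname{rank}(\alpha)=|\operatorname{im}(\alpha)|$ and $\ker(\alpha)=\{(i,j)\in\operatorname{dom}(\alpha)\times\operatorname{dom}(\alpha): i\alpha=j\alpha\}$. If $\operatorname{dom}(\alpha)=\{i_1<\cdots<i_k\}$, then $\alpha$ is order-preserving if $i_1\alpha\le\cdots\le i_k\alpha$, and order-reversing if $i_1\alpha\ge\cdots\ge i_k\alpha$. $i\gamma_n=n-i+1$ for all $i$. Define $J_{n-1}=\{\alpha\in\mathcal{PT}_n:\operatorname{rank}(\alpha)=n-1\}$ and, for distinct $i,j\in\{1,\ldots,n\}$: $L_i=\{\alpha\in J_{n-1}: i\notin\operatorname{im}(\alpha)\}$, $R_i=\{\alpha\in J_{n-1}: i\notin\operatorname{dom}(\alpha)\}$, $R_{\{i,j\}}=\{\alpha\in J_{n-1}:(i,j)\in\ker(\alpha)\}$. In the submonoid, $\mathscr{L}$-, $\mathscr{R}$- and $\mathscr{J}$-equivalence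 are equality of image, kernel, and rank, respectively. Types: a maximal subsemigroup $M$ of a finite monoid $S$ arises from the $\mathscr{J}$-class $J$ if $S\setminus M\subseteq J$; when $J$ is regular, $M$ has type (M1) if $M\cap J=\varnothing$; (M2) if $M\cap J$ is a non-empty union of both $\mathscr{L}$- and $\mathscr{R}$-classes of $J$ (those in a non-empty proper subset of the $\mathscr{L}$-classes together with those in a non-empty proper subset of the $\mathscr{R}$-classes); (M3) if $M\cap J$ is a non-empty union of $\mathscr{L}$-classes; (M4) if $M\cap J$ is a non-empty union of $\mathscr{R}$-classes; (M5) if $M\cap J$ meets every $\mathscr{H}$-class of $J$. *)

(* Defs.v *)
From HB Require Import structures.
From mathcomp Require Import all_boot.

Set Implicit Arguments.
Unset Strict Implicit.
Unset Printing Implicit Defensive.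

Local Open Scope group_scope.

#[short(type="finMonoidType")]
HB.structure Definition FinMonoid := {T of Finite T & Monoid T}.

(* Sub(semi)groups and submonoids are handled as sets of elements of an ambient
   finite monoid. *)
Section Subsemigroups.

Variable T : finMonoidType.
Implicit Types (S M J : {set T}) (a b : T).

Definition subsemigroup M :=
  (M != set0) && [forall a in M, forall b in M, a * b \in M].

Definition maximal_subsemigroup S M :=
  maxset (fun X : {set T} => subsemigroup X && (X \proper S)) M.

Definition semilattice S :=
  [/\ subsemigroup S, {in S &, commutative (@mul T)}
    & {in S, forall a, a * a = a}].

(* Green's relations of S. The principal ideals are S a, a S and S a S (rather
   than S^1 a, ...), which is adequate because S is always a monoid below. *)
Definition greenL S a b := [set s * a | s in S] == [set s * b | s in S].
Definition greenR S a b := [set a * s | s in S] == [set b * s | s in S].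
Definition greenH S a b := greenL S a b && greenR S a b.
Definition greenJ S a b :=
  [set s * a * t | s in S, t in S] == [set s * b * t | s in S, t in S].

(* The classes of the relation [e] on S that have a representative in J. *)
Definition classes_in (e : {set T} -> rel T) S J : {set {set T}} :=
  [set [set b in S | e S a b] | a in J].

Definition regular S J := [forall a in J, exists x in S, a * x * a == a].

Definition arises_from S M J :=
  [/\ J \in classes_in greenJ S S, regular S J & S :\: M \subset J].

(* Shapes that the trace on J of a maximal subsemigroup M arising from J can
   take: L- and R-classes (M2), R-classes only (M4), or all H-classes met (M5). *)
Definition type_M2 S M := exists2 J, arises_from S M J &
  exists X Y : {set {set T}},
    [/\ X != set0, X \proper classes_in greenL S J,
        Y != set0, Y \proper classes_in greenR S J
      & M :&: J = cover X :|: cover Y].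

Definition type_M4 S M := exists2 J, arises_from S M J &
  exists2 Y : {set {set T}}, Y \subset classes_in greenR S J &
    M :&: J = cover Y /\ M :&: J != set0.

Definition type_M5 S M := exists2 J, arises_from S M J &
  {in classes_in greenH S J, forall H, (M :&: J) :&: H != set0}.

End Subsemigroups.

(* The point k of {1, ..., n} is the ordinal k - 1 : 'I_n, so that n - k + 1
   corresponds to [rev_ord]; [None] means "undefined". *)
Definition PT n := {ffun 'I_n -> option 'I_n}.

HB.instance Definition _ n := Finite.on (PT n).

Section PTMonoid.

Variable n : nat.
Implicit Types a b c : PT n.

Definition pt_one : PT n := [ffun i => Some i].

(* Maps are written on the right: a * b is a followed by b. *)
Definition pt_mul a b : PT n := [ffun i => obind b (a i)].

Lemma pt_mulA : associative pt_mul.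
Proof.
move=> a b c; apply/ffunP=> i; rewrite !ffunE.
by case: (a i) => //= x; rewrite ffunE.
Qed.

Lemma pt_mul1 : left_id pt_one pt_mul.
Proof. by move=> a; apply/ffunP=> i; rewrite !ffunE. Qed.

Lemma pt_mulr1 : right_id pt_one pt_mul.
Proof.
move=> a; apply/ffunP=> i; rewrite !ffunE.
by case: (a i) => //= x; rewrite ffunE.
Qed.

HB.instance Definition _ :=
  isMonoid.Build (PT n) pt_mulA pt_mul1 pt_mulr1.

End PTMonoid.

Section POD.

Variable n : nat.
Implicit Types (a : PT n) (i j : 'I_n).

Definition dom a : {set 'I_n} := [set i | a i != None].
Definition im a : {set 'I_n} := [set y | [exists i, a i == Some y]].
Definition rank a := #|im a|.
Definition ker a : {set 'I_n * 'I_n} :=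
  [set p | [&& p.1 \in dom a, p.2 \in dom a & a p.1 == a p.2]].

Definition order_preserving a :=
  [forall i, forall j, forall x, forall y,
    [&& a i == Some x, a j == Some y & i <= j] ==> (x <= y)].

Definition order_reversing a :=
  [forall i, forall j, forall x, forall y,
    [&& a i == Some x, a j == Some y & i <= j] ==> (y <= x)].

Definition POD : {set PT n} :=
  [set a | order_preserving a || order_reversing a].

Definition gamma : PT n := [ffun i => Some (rev_ord i)].

(* J_(n-1), L_i, R_i and R_{i,j} of PT n; they are restricted to POD where they
   are used. *)
Definition Jrank : {set PT n} := [set a | rank a == n.-1].
Definition Lmiss i : {set PT n} := [set a in Jrank | i \notin im a].
Definition Rmiss i : {set PT n} := [set a in Jrank | i \notin dom a].
Definition Rker i j : {set PT n} := [set a in Jrank | (i, j) \in ker a].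

(* {1, ..., ceil(n / 2)} *)
Definition lower_half : {set 'I_n} := [set i : 'I_n | i < uphalf n].

Definition Lpair i := Lmiss i :|: Lmiss (rev_ord i).
Definition Rpair i := Rmiss i :|: Rmiss (rev_ord i).
(* For j = i + 1, the second set is R_{n-i, n-i+1}. *)
Definition Kpair i j := Rker i j :|: Rker (rev_ord j) (rev_ord i).

Definition POD_of (A : {set 'I_n}) : {set PT n} :=
  (POD :\: Jrank)
  :|: (\bigcup_(i in A) (Lpair i :&: POD)
   :|: \bigcup_(i in lower_half | i \notin A) (Rpair i :&: POD)
   :|: \bigcup_(i : 'I_n | i < n./2)
         \bigcup_(j : 'I_n | [&& j == i.+1 :> nat, i \notin A & j \notin A])
           (Kpair i j :&: POD)).

Lemma order_preservingP a :
  reflect (forall i j x y, a i = Some x -> a j = Some y -> i <= j -> x <= y)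
          (order_preserving a).
Proof.
apply: (iffP idP) => [H i j x y ai aj ij | H].
  move/forallP: H => /(_ i)/forallP/(_ j)/forallP/(_ x)/forallP/(_ y)/implyP.
  by apply; rewrite ai aj ij !eqxx.
do 4![apply/forallP => ?]; apply/implyP => /and3P[/eqP ai /eqP aj].
exact: H ai aj.
Qed.

Lemma order_reversingP a :
  reflect (forall i j x y, a i = Some x -> a j = Some y -> i <= j -> y <= x)
          (order_reversing a).
Proof.
apply: (iffP idP) => [H i j x y ai aj ij | H].
  move/forallP: H => /(_ i)/forallP/(_ j)/forallP/(_ x)/forallP/(_ y)/implyP.
  by apply; rewrite ai aj ij !eqxx.
do 4![apply/forallP => ?]; apply/implyP => /and3P[/eqP ai /eqP aj].
exact: H ai aj.
Qed.

Lemma POD_monoid : monoid_closed POD.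
Proof.
split=> [|a b].
  rewrite inE; apply/orP; left; apply/order_preservingP => i j x y.
  by rewrite !ffunE => -[<-] [<-].
have mulP i x : (a * b) i = Some x -> exists2 z, a i = Some z & b z = Some x.
  by rewrite ffunE; case: (a i) => //= z bz; exists z.
rewrite !inE => /orP[/order_preservingP Ha | /order_reversingP Ha]
  /orP[/order_preservingP Hb | /order_reversingP Hb]; apply/orP;
  [left; apply/order_preservingP | right; apply/order_reversingP
  |right; apply/order_reversingP | left; apply/order_preservingP];
  move=> i j x y /mulP[u ai bu] /mulP[v aj bv] ij;
  by [apply: Hb bu bv _; apply: Ha ai aj ij
     |apply: Hb bv bu _; apply: Ha ai aj ij].
Qed.

End POD.

(* Main.v *)
Require Import Defs.
From mathcomp Require Import all_boot zify.

Set Implicit Arguments.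
Unset Strict Implicit.
Unset Printing Implicit Defensive.

Local Open Scope group_scope.

(**
Write n = m + 1, S for the monoid, g for its order-reversing unit, and J for
the set of its elements of rank m.  The units of S are 1 and g, and everything
rests on coordinates for J.

An element of J is determined by its kernel, by the point l missing from its
image, and by a sign s telling whether it reverses the order.  Its kernel is
given by an index r, which names either the one point left out of the domain,
or a pair i, i + 1 of consecutive points identified by an otherwise injective
total map ([eltP]).  The product of (r, l, s) and (r', l', s') is
(r, l', s + s') if every kernel class of r' has exactly one point other than l
(l is then transverse to r', [elt_mul]), and it has rank less than m otherwise
([elt_mul_lower]).  Multiplying by g on the left reflects r and on the right
reflects l; both change s ([gamma_elt], [elt_gamma]).

Moreover J and g generate S ([POD_generated]).  A partial order-preserving map
is the restriction of a total one to its domain, and a restriction is a product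
of restrictions that each leave out one point.  A total order-preserving map f
other than 1 moves some point up, or else its conjugate by g does; a map that
moves some point up factors as an element of J followed by a total map that is
closer to the identity ([lower_one_value]).

Let M be a proper subsemigroup.  If g is not in M, then M lies in S without g.
Otherwise let C r be the set of those l for which M contains (r, l, s) for some
s.  It is invariant under reflection, and any l' in C r', where some l in C r
is transverse to r', is also in C r.  If some C r is empty, M misses the
R-class of r and its reflection.  If some C r is neither empty nor full, the
closure property says that M is contained in [LR_union B] for B = C r.  If all the C r are full, then M meets every H-class of J; since the
reflection fixes a point l, or else a kernel index r, M contains an H-class
completely, so it contains J, and hence M = S.  This is [proper_sub_candidate].

Conversely the sets found in this way are proper subsemigroups, and none is
contained in another ([candidate_antichain]).  So they are exactly the maximal
subsemigroups ([maximal_candidate]).  Subsets of the points that are closed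
under reflection correspond to subsets of the lower half, which gives
2 ^ ceil(n / 2) - 2 sets [LR_union B], and the R-classes of J form
ceil(n / 2) + floor(n / 2) = n orbits under reflection; with S without g, this
gives the number of maximal subsemigroups.
*)

(** * Monotone maps between chains *)

Section FiniteOrder.

Variable m : nat.
Implicit Types (f t : 'I_m -> 'I_m) (g : 'I_m -> option 'I_m).

(** By induction f x is at least x; the reverse inequality is this one for
the conjugate of f by the reflection. *)
Lemma increasing_id f : {homo f : x y / x < y >-> x < y} -> f =1 id.
Proof.
have geid (h : 'I_m -> 'I_m) :
    {homo h : x y / x < y >-> x < y} -> forall x : 'I_m, x <= h x.
  move=> hm [x ltxm]; elim: x ltxm => //= x IHx ltxm.
  have ltx : x < m by lia.
  exact: leq_ltn_trans (IHx ltx) (hm (Ordinal ltx) (Ordinal ltxm) (leqnn _)).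
move=> fm x; apply/val_inj/eqP; rewrite eqn_leq andbC (geid f) //=.
(* Conjugating by the reflection turns x <= f x into f x <= x. *)
have /geid/(_ (rev_ord x)) : {homo (fun y => rev_ord (f (rev_ord y))) :
    y z / y < z >-> y < z}.
  move=> y z ltyz /=; have /fm : rev_ord z < rev_ord y by move=> /=; have := ltn_ord z; lia.
  have := ltn_ord (f (rev_ord y)); lia.
by rewrite rev_ordK /=; have := ltn_ord (f x); lia.
Qed.

(** A partial self-map of a finite set that is onto is total and bijective; t is
its inverse. *)
Lemma surj_option_section g : (forall z, exists y, g y = Some z) ->
  exists2 t, bijective t & forall y, g (t y) = Some y.
Proof.
move/fin_all_exists => [t gt]; exists t => //.
by apply: injF_bij => x y eqt; apply/Some_inj; rewrite -!gt eqt.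
Qed.

Lemma monotone_surj_option_id g :
    (forall x y u v, g x = Some u -> g y = Some v -> x <= y -> u <= v) ->
    (forall z, exists y, g y = Some z) ->
  forall y, g y = Some y.
Proof.
move=> gm /surj_option_section[t [t' tK t'K] gt] y.
have tid : t =1 id.
  apply: increasing_id => x z ltxz; rewrite ltnNge; apply/negP => letzx.
  by have := gm _ _ _ _ (gt z) (gt x) letzx; lia.
by rewrite -{1}[y]tid gt.
Qed.

End FiniteOrder.

(** * Rank and units *)

Section Rank.

Variable n : nat.
Implicit Types (a b : PT n).

Lemma mulE a b x : (a * b) x = obind b (a x).
Proof. exact: ffunE. Qed.

Lemma imP a y : reflect (exists x, a x = Some y) (y \in im a).
Proof. by rewrite inE; apply: (iffP existsP) => -[x /eqP]; exists x. Qed.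

Lemma im_mulr a b : im (a * b) \subset im b.
Proof.
apply/subsetP => y /imP[x]; rewrite mulE.
by case: (a x) => //= z bz; apply/imP; exists z.
Qed.

Lemma rank_mulr a b : rank (a * b) <= rank b.
Proof. exact: subset_leq_card (im_mulr a b). Qed.

Lemma rank_mull a b : rank (a * b) <= rank a.
Proof.
have sub : [set Some y | y in im (a * b)] \subset [set b z | z in im a].
  apply/subsetP => _ /imsetP[y /imP[x +] ->]; rewrite mulE.
  case ax: (a x) => [z|] //= bz.
  by apply/imsetP; exists z => //; apply/imP; exists x.
rewrite /rank -(card_imset (im (a * b)) (@Some_inj _)).
exact: leq_trans (subset_leq_card sub) (leq_imset_card _ _).
Qed.

Lemma gamma_invol : gamma n * gamma n = 1.
Proof. by apply/ffunP => x; rewrite !ffunE /= ffunE rev_ordK. Qed.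

Lemma gammaK a : a * gamma n * gamma n = a.
Proof. by rewrite -mulgA gamma_invol mulg1. Qed.

Lemma gammaVK a : gamma n * (gamma n * a) = a.
Proof. by rewrite mulgA gamma_invol mul1g. Qed.

Lemma rank_mul_gamma a : rank (a * gamma n) = rank a.
Proof.
by apply/eqP; rewrite eqn_leq rank_mull /= -{1}[a]gammaK rank_mull.
Qed.

Lemma one_POD : 1 \in POD n. Proof. by have [] := POD_monoid n. Qed.

Lemma mul_POD a b : a \in POD n -> b \in POD n -> a * b \in POD n.
Proof. by have [_] := POD_monoid n; apply. Qed.

Lemma gamma_POD : gamma n \in POD n.
Proof.
rewrite inE; apply/orP; right; apply/order_reversingP => i j x y.
rewrite !ffunE => -[<-] [<-] /=; lia.
Qed.

Lemma order_reversing_mul_gamma a :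
  order_reversing a -> order_preserving (a * gamma n).
Proof.
move/order_reversingP => ra; apply/order_preservingP => i j x y.
rewrite !mulE; case ai: (a i) => [u|] //=; case aj: (a j) => [v|] //=.
rewrite !ffunE => -[<-] [<-] leij /=; have := ra _ _ _ _ ai aj leij; lia.
Qed.

End Rank.

Section Units.

Variable n : nat.
Implicit Types (a b : PT n).

Lemma rank_le_n a : rank a <= n.
Proof. by have := max_card [in im a]; rewrite card_ord. Qed.

Lemma order_preserving_full_rank a :
  order_preserving a -> rank a = n -> a = 1.
Proof.
move=> /order_preservingP am rk.
have imT : im a = setT.
  by apply/eqP; rewrite eqEcard subsetT cardsT card_ord -/(rank a) rk leqnn.
apply/ffunP => x; rewrite ffunE; apply: monotone_surj_option_id => [i j u v|z]; first exact: am.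
by apply/imP; rewrite imT inE.
Qed.

Lemma POD_full_rank a : a \in POD n -> rank a = n -> a = 1 \/ a = gamma n.
Proof.
rewrite inE => /orP[oa|ra] rk; first by left; exact: order_preserving_full_rank.
right; rewrite -[a]gammaK (_ : a * gamma n = 1) ?mul1g //.
apply: order_preserving_full_rank (order_reversing_mul_gamma ra) _.
by rewrite rank_mul_gamma.
Qed.

Lemma rank_gamma : rank (gamma n) = n.
Proof.
rewrite /rank (_ : im _ = setT) ?cardsT ?card_ord //.
apply/setP => y; rewrite !inE; apply/existsP; exists (rev_ord y).
by rewrite ffunE rev_ordK.
Qed.

Lemma rank_one : rank (1 : PT n) = n.
Proof. by rewrite -(gamma_invol n) rank_mul_gamma rank_gamma. Qed.

End Units.

(** * Coordinates on the elements of rank n - 1 *)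

Section Coordinates.

Variable m : nat.
Implicit Types (x l : 'I_m.+1) (i y : 'I_m) (s : bool).

(** Index of the kernel of an element of rank m.  The index [inl i] stands for the
equality on all points but i, which is left out of the domain; [inr i] stands
for the total kernel whose only nontrivial class is {i, i + 1}. *)
Definition kernel_index := ('I_m.+1 + 'I_m)%type.
Implicit Types r : kernel_index.

(** The partial map of the chain of m + 1 points onto that of m points which has
kernel r and preserves the order.  For [inr i], the point i is excluded by
[unlift] and gets the default value i, which is also the value at i + 1. *)
Definition kproj r x : option 'I_m :=
  match r with
  | inl i => unlift i x
  | inr i => Some (odflt i (unlift (lift ord_max i) x))
  end.

(** The order automorphism or antiautomorphism of the chain of m points with
sign s. *)
Definition flip s y := if s then rev_ord y else y.

(** The element of rank m with kernel r, with image all points but l, and which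
reverses the order if s is true.  For m at most 1 the sign makes no difference. *)
Definition elt r l s : PT m.+1 :=
  [ffun x => omap (fun y => lift l (flip s y)) (kproj r x)].

(** The points other than l form a transversal of the kernel with index r. *)
Definition transverse l r :=
  match r with
  | inl i => l == i
  | inr i => (l == i :> nat) || (l == i.+1 :> nat)
  end.

(** The index of the reflected kernel: reflecting {i, i + 1} in the chain of m + 1
points amounts to reflecting i in the chain of m points. *)
Definition rev_index r : kernel_index :=
  match r with inl i => inl (rev_ord i) | inr i => inr (rev_ord i) end.

Lemma flipK s : involutive (flip s).
Proof. by case: s => y //=; rewrite rev_ordK. Qed.

Lemma flip_flip s s' y : flip s' (flip s y) = flip (s (+) s') y.
Proof. by case: s; case: s' => //=; rewrite rev_ordK. Qed.

Lemma kproj_inl (i : 'I_m.+1) x u :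
  kproj (inl i) x = Some u -> x != i /\ u = unbump i x :> nat.
Proof.
rewrite /=; case: unliftP => //= j -> [<-].
by rewrite eq_sym neq_lift /= bumpK.
Qed.

Lemma kproj_inr i x : exists2 u, kproj (inr i) x = Some u & u = unbump i x :> nat.
Proof.
eexists; first by [].
rewrite /unbump; case: unliftP => [j ->|->] /=; rewrite /bump /=; have := ltn_ord i; lia.
Qed.

Lemma kproj_mono r x x' u v :
  kproj r x = Some u -> kproj r x' = Some v -> x <= x' -> u <= v.
Proof.
case: r => i.
  by move=> /kproj_inl[? ->] /kproj_inl[? ->]; rewrite /unbump; lia.
have [u' -> eu] := kproj_inr i x; have [v' -> ev] := kproj_inr i x'.
by move=> [<-] [<-]; rewrite eu ev /unbump; lia.
Qed.

Lemma kproj_transverse l r y : transverse l r -> kproj r (lift l y) = Some y.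
Proof.
case: r => i /= cmp; first by rewrite (eqP cmp) liftK.
have [u /= -> eu] := kproj_inr i (lift l y); congr Some; apply/val_inj.
rewrite /= eu /unbump /= /bump; lia.
Qed.

Lemma transverse_ex r : exists l, transverse l r.
Proof.
by case: r => i; [exists i => /= | exists (lift ord_max i); rewrite /transverse lift_max eqxx].
Qed.

Lemma kproj_surj r y : exists x, kproj r x = Some y.
Proof.
by have [l /kproj_transverse lr] := transverse_ex r; exists (lift l y).
Qed.

Lemma im_elt r l s : im (elt r l s) = ~: [set l].
Proof.
apply/setP => z; rewrite in_setC1; apply/imP/idP => [[x]|].
  by rewrite ffunE; case: kproj => //= y [<-]; rewrite eq_sym neq_lift.
rewrite eq_sym => /unlift_some[y -> _].
have [x xy] := kproj_surj r (flip s y); exists x.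
by rewrite ffunE xy /= flipK.
Qed.

Lemma elt_Jrank r l s : elt r l s \in Jrank m.+1.
Proof. by rewrite inE /rank im_elt cardsC1 card_ord. Qed.

Lemma elt_POD r l s : elt r l s \in POD m.+1.
Proof.
rewrite inE; case: s; apply/orP; [right; apply/order_reversingP|
  left; apply/order_preservingP] => x x' u v; rewrite !ffunE;
  case kx: (kproj r x) => [y|] //=; case kx': (kproj r x') => [y'|] //=;
  move=> [<-] [<-] /(kproj_mono kx kx'); rewrite /= /bump; lia.
Qed.

Lemma elt_mul r l s r' l' s' : transverse l r' ->
  elt r l s * elt r' l' s' = elt r l' (s (+) s').
Proof.
move=> lr'; apply/ffunP => x; rewrite mulE !ffunE.
case: kproj => //= y; rewrite ffunE kproj_transverse //=.
by rewrite flip_flip.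
Qed.

(** If the product had rank m, the partial self-map that sends y to
[kproj r' (lift l y)] would be onto, hence total and injective.  But it is
undefined at a point, or it identifies two points. *)
Lemma elt_mul_lower r l s r' l' s' : ~~ transverse l r' ->
  elt r l s * elt r' l' s' \notin Jrank m.+1.
Proof.
move=> Nlr'; apply/negP; rewrite inE /rank => /eqP rk.
have eq_im : im (elt r l s * elt r' l' s') = ~: [set l'].
  apply/eqP; rewrite eqEcard -(im_elt r' l' s') im_mulr.
  by rewrite rk im_elt cardsC1 card_ord /=.
have gsurj z : exists y, kproj r' (lift l y) = Some z.
  have /imP[x] : lift l' (flip s' z) \in im (elt r l s * elt r' l' s').
    by rewrite eq_im in_setC1 eq_sym neq_lift.
  rewrite mulE ffunE; case: kproj => //= y; rewrite ffunE.
  case ky : (kproj _ _) => [y'|] //= /Some_inj/lift_inj/(can_inj (flipK s')) <-.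
  by exists (flip s y).
have [t [t' tK t'K] gt] := surj_option_section gsurj.
case: r' Nlr' gt {gsurj eq_im rk} => i /= Nli gt.
  have [y def_i _] := unlift_some Nli.
  by have := gt (t' y); rewrite t'K -def_i unlift_none.
have {}gt y : kproj (inr i) (lift l y) = Some (t' y) by rewrite -gt t'K.
have lt0 : i < m.+1 by have := ltn_ord i; lia.
have lt1 : i.+1 < m.+1 by have := ltn_ord i; lia.
have /unlift_some[y0 def0 _] : l != Ordinal lt0 by rewrite -val_eqE /=; lia.
have /unlift_some[y1 def1 _] : l != Ordinal lt1 by rewrite -val_eqE /=; lia.
have [u0] := kproj_inr i (Ordinal lt0); have [u1] := kproj_inr i (Ordinal lt1).
rewrite {1}def0 {1}def1 !gt /= => -[<-] e1 [<-] e0.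
have /(can_inj t'K) e : t' y0 = t' y1 by apply/val_inj; rewrite /= e0 e1 /unbump /=; lia.
by have := congr1 val (etrans def0 (etrans (congr1 _ e) (esym def1))) => /=; lia.
Qed.

Lemma kproj_rev r x : kproj r (rev_ord x) = omap (@rev_ord m) (kproj (rev_index r) x).
Proof.
case: r => i; last first.
  have [u -> eu] := kproj_inr i (rev_ord x).
  have [v + ev] := kproj_inr (rev_ord i) x; rewrite [rev_index _]/= => ->; congr Some.
  apply/val_inj; rewrite /= eu ev /= /unbump; have := ltn_ord i; have := ltn_ord x; lia.
case ex: (kproj _ x) => [v|] /=; last first.
  by move: ex => /=; case: unliftP => // -> _; rewrite rev_ordK unlift_none.
have [nex ev] := kproj_inl ex.
have /unlift_some[u def_u -> /=] : i != rev_ord x.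
  by apply: contraNneq nex => ->; rewrite rev_ordK.
congr Some; apply/val_inj => /=.
have := congr1 val def_u; rewrite /= ev /unbump /bump /=.
have := ltn_ord i; have := ltn_ord x; have := ltn_ord u; have := ltn_ord v.
move: nex; rewrite -val_eqE /=; lia.
Qed.

Lemma rev_lift l y : rev_ord (lift l y) = lift (rev_ord l) (rev_ord y).
Proof.
apply/val_inj; rewrite /= /bump; have := ltn_ord l; have := ltn_ord y; lia.
Qed.

Lemma gamma_elt r l s : gamma m.+1 * elt r l s = elt (rev_index r) l (~~ s).
Proof.
apply/ffunP => x; rewrite mulE !ffunE /= ffunE kproj_rev.
by case: kproj => //= y; case: s => //=; rewrite rev_ordK.
Qed.

Lemma elt_gamma r l s : elt r l s * gamma m.+1 = elt r (rev_ord l) (~~ s).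
Proof.
apply/ffunP => x; rewrite mulE !ffunE.
case: kproj => //= y; rewrite ffunE rev_lift.
by case: s => //=; rewrite rev_ordK.
Qed.

Lemma elt_im_inj r l s r' l' s' : elt r l s = elt r' l' s' -> l = l'.
Proof.
move/(congr1 (@im _)); rewrite !im_elt => /setC_inj/set1_inj //.
Qed.

Lemma dom_elt r l s (i : 'I_m.+1) :
  (i \notin dom (elt r l s)) = (r == inl i).
Proof.
rewrite inE negbK ffunE; case: r => j /=; last by [].
case: unliftP => [y ->|->] /=; last by rewrite !eqxx.
by apply/esym/negbTE; apply/eqP => -[] /eqP; rewrite (negbTE (neq_lift _ _)).
Qed.

Lemma ker_elt r l s x x' : x < x' ->
  ((x, x') \in ker (elt r l s)) =
  if r is inr i then (x == i :> nat) && (x' == i.+1 :> nat) else false.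
Proof.
move=> ltxx'; rewrite inE /= !inE !ffunE; case: r => i.
  case ex: (kproj _ x) => [u|]; case ex': (kproj _ x') => [u'|] //=.
  apply/eqP => /Some_inj/lift_inj/(can_inj (flipK s))/(congr1 val) /=.
  have [+ ->] := kproj_inl ex; have [+ ->] := kproj_inl ex'.
  rewrite -!val_eqE /= /unbump; lia.
have [u -> eu] := kproj_inr i x; have [v -> ev] := kproj_inr i x'.
rewrite (inj_eq (@Some_inj _)) (inj_eq lift_inj) (inj_eq (can_inj (flipK s))).
rewrite -val_eqE /= eu ev /unbump; lia.
Qed.

Lemma elt_index_inj r l s r' l' s' : elt r l s = elt r' l' s' -> r = r'.
Proof.
case: r => [i|i] eqe.
  by have /esym := dom_elt (inl i) l s i; rewrite eqe dom_elt eqxx => /esym/eqP.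
have lti : lift ord_max i < lift ord0 i by rewrite lift_max lift0.
have := ker_elt (inr i) l s lti; rewrite eqe ker_elt // lift_max lift0 !eqxx.
by case: r' {eqe} => // j /andP[/eqP eij _]; congr inr; apply/val_inj.
Qed.

(** Removing from the chain a point outside the domain, or the second point of a
nontrivial kernel class, leaves a monotone partial map of a chain of m points
onto the image, a chain of m points, which must be the identity. *)
Lemma order_preserving_elt (a : PT m.+1) :
  order_preserving a -> rank a = m -> exists r l, a = elt r l false.
Proof.
move=> /order_preservingP am rk.
have /cards1P[l eqC] : #|~: im a| == 1%N.
  by have := cardsC (im a); rewrite -/(rank a) rk card_ord; lia.
have imE : im a = ~: [set l] by rewrite -eqC setCK.
pose g x := obind (unlift l) (a x).
have ag x : a x = omap (lift l) (g x).
  rewrite /g; case ax: (a x) => [z|] //=.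
  have /unlift_some[y -> ->] // : l != z.
  have : z \in im a by apply/imP; exists x.
  by rewrite imE in_setC1 eq_sym.
have gsurj y : exists x, g x = Some y.
  have /imP[x ax] : lift l y \in im a by rewrite imE in_setC1 eq_sym neq_lift.
  by exists x; rewrite /g ax /= liftK.
have gm x x' u v : g x = Some u -> g x' = Some v -> x <= x' -> u <= v.
  move=> gx gx' /(am _ _ (lift l u) (lift l v)); rewrite !ag gx gx' /= /bump.
  by move=> /(_ erefl erefl); lia.
(* A point i may be removed if its value, when defined, is taken elsewhere. *)
have drop_id (i : 'I_m.+1) :
    (forall u, g i = Some u -> exists2 x : 'I_m.+1, x != i & g x = Some u) ->
    forall y, g (lift i y) = Some y.
  move=> gi; apply: monotone_surj_option_id => [x x' u v gx gx' lexx'|z].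
    by apply: gm gx gx' _; rewrite /= /bump; lia.
  have [x gx] := gsurj z; have [eqxi|] := eqVneq x i.
    have [x1 + gx1] : exists2 x1, x1 != i & g x1 = Some z by apply: gi; rewrite -eqxi.
    rewrite eq_sym => /unlift_some[y def_y _].
    by exists y; rewrite -def_y.
  by rewrite eq_sym => /unlift_some[y def_y _]; exists y; rewrite -def_y.
have [/existsP[i /eqP gi]|/existsPn gtot] := boolP [exists i, g i == None].
  exists (inl i), l; apply/ffunP => x; rewrite ffunE ag /=.
  case: unliftP => [y ->|->]; last by rewrite gi.
  by rewrite drop_id // => u; rewrite gi.
(* Now g is total, so it identifies two points by the pigeonhole principle,
   and then two consecutive points by monotonicity. *)
have /fin_all_exists[f gf] x : exists y, g x = Some y.
  by have := gtot x; case: (g x) => // y _; exists y.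
have [x [x' ltxx' eqf]] : exists x : 'I_m.+1, exists2 x' : 'I_m.+1, x < x' & f x = f x'.
  have /injectivePn[x [x' nexx' eqf]] : ~~ injectiveb f.
    by apply/injectiveP => /leq_card; rewrite !card_ord ltnn.
  move: nexx'; rewrite -val_eqE neq_ltn => /orP[lt|lt]; first by exists x, x'.
  by exists x', x.
have ltxm : x < m by have := ltn_ord x'; lia.
pose i := Ordinal ltxm; pose i0 := lift ord_max i; pose i1 := lift ord0 i.
have x0 : i0 = x by apply/val_inj; exact: (lift_max i).
have gi : g i1 = g i0.
  rewrite x0 !gf; congr Some; apply/val_inj/eqP; rewrite eqn_leq.
  rewrite [in X in X && _]eqf (gm _ _ _ _ (gf i1) (gf x')) //=.
  by rewrite (gm _ _ _ _ (gf x) (gf i1)) //= /bump /=; lia.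
have ne10 : i1 != i0 by rewrite -val_eqE /= /bump /=; lia.
exists (inr i), l; apply/ffunP => z; rewrite ffunE ag /= -/i0.
have drop := drop_id i0 (fun u gu => ex_intro2 _ _ i1 ne10 (etrans gi gu)).
case: unliftP => [y ->|->] /=; first by rewrite drop.
rewrite -gi; have -> : i1 = lift i0 i by apply/val_inj; rewrite /= /bump /=; lia.
by rewrite drop.
Qed.

(** The coordinates describe all elements of rank m; an order-reversing element is
obtained by following an order-preserving one by the reflection. *)
Lemma eltP (a : PT m.+1) :
  reflect (exists r l s, a = elt r l s) (a \in Jrank m.+1 :&: POD m.+1).
Proof.
apply: (iffP setIP) => [[] | [r [l [s ->]]]]; last by rewrite elt_Jrank elt_POD.
rewrite !inE => /eqP rk /orP[oa | ra].
  by have [r [l ->]] := order_preserving_elt oa rk; exists r, l, false.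
have [|r [l eq_a]] := order_preserving_elt (order_reversing_mul_gamma ra).
  by rewrite rank_mul_gamma.
by exists r, (rev_ord l), true; rewrite -[a]gammaK eq_a elt_gamma.
Qed.

End Coordinates.

(** * Generation by the elements of rank n - 1 and the order-reversing unit *)

Section Generation.

Variable m : nat.
Implicit Types (a : PT m.+1) (f : 'I_m.+1 -> 'I_m.+1) (D : {set 'I_m.+1}).

(** A total map, seen as a partial one. *)
Definition total_map f : PT m.+1 := [ffun x => Some (f x)].

(** The partial identity with domain D. *)
Definition partial_one D : PT m.+1 := [ffun x => if x \in D then Some x else None].

(** Total displacement of f.  As subtraction is truncated, each term is the
distance between x and f x. *)
Definition deviation f := \sum_(x : 'I_m.+1) (f x - x + (x - f x)).

(** If x is the last point with x < f x, then f x = f (x + 1) = x + 1.  If p is the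
first point with that value, then f takes the same value at p and p + 1.  So the
value at p does not matter after the map that sends p to p + 1 and fixes all
other points, and it may be lowered to x. *)
Lemma lower_one_value f (x0 : 'I_m.+1) :
    {homo f : x y / x <= y >-> x <= y} -> x0 < f x0 ->
  exists2 f' : 'I_m.+1 -> 'I_m.+1,
    {homo f' : x y / x <= y >-> x <= y} /\ deviation f' < deviation f
    & exists r l s, total_map f = elt r l s * total_map f'.
Proof.
move=> fm ltx0.
case: (@arg_maxnP _ x0 (fun x => x < f x) val ltx0) => /= x ltx xmax.
have ltx1 : x.+1 < m.+1 by have := ltn_ord (f x); lia.
have fx1 : f (Ordinal ltx1) <= x.+1.
  by rewrite leqNgt; apply/negP => /(xmax (Ordinal ltx1)) /=; lia.
have fx : f x = x.+1 :> nat.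
  by have := fm x (Ordinal ltx1) (leqnSn _); lia.
case: (@arg_minnP _ x (fun y => f y == f x) val (eqxx _)) => /= p /eqP fp pmin.
have lepx : p <= x by apply: pmin.
have lt_below (y : 'I_m.+1) : y < p -> f y <= x.
  move=> ltyp; have := fm y p (ltnW ltyp); rewrite fp fx leq_eqVlt ltnS.
  by case/orP => // /eqP fy; have := pmin y; rewrite -val_eqE /= fy fx eqxx; lia.
have ltpm : p < m by lia.
pose f' y := if y == p then x else f y.
exists f'; first split.
- move=> y z leyz; rewrite /f'; have [eqy|ney] := eqVneq y p; have [eqz|nez] := eqVneq z p => //.
  + by have := fm p z; rewrite -{1}eqy fp fx => /(_ leyz); lia.
  + by apply: lt_below; move: ney leyz; rewrite eqz -val_eqE /=; lia.
  + exact: fm.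
- rewrite /deviation (bigD1 p) //= [X in _ < X](bigD1 p) //= fp fx /f' eqxx.
  rewrite (eq_bigr (fun y => f y - y + (y - f y))); last by move=> y /negPf->.
  lia.
exists (inr (Ordinal ltpm)), p, false; apply/ffunP => y; rewrite mulE !ffunE.
have [u -> /= eu] := kproj_inr (Ordinal ltpm) y; rewrite ffunE; congr Some.
rewrite /f'; have [eqy|ney] := eqVneq y p; last first.
  suff -> : lift p u = y by rewrite (negPf ney).
  by apply/val_inj; move: ney; rewrite -val_eqE /= eu /bump /unbump; lia.
have eqv : lift p u = p.+1 :> nat by rewrite /= eu eqy /bump /unbump; lia.
have nev : lift p u != p by apply/eqP => e; move: eqv; rewrite e; lia.
rewrite (negPf nev) eqy; apply/val_inj => /=; have := fm p (lift p u); rewrite fp fx eqv.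
have := fm (lift p u) (Ordinal ltx1); rewrite eqv /=; lia.
Qed.

Lemma total_map_rev f :
  total_map (fun x => rev_ord (f (rev_ord x))) =
  gamma m.+1 * total_map f * gamma m.+1.
Proof. by apply/ffunP => x; rewrite !mulE !ffunE /= !ffunE /= ffunE. Qed.

Lemma deviation_rev f : deviation (fun x => rev_ord (f (rev_ord x))) = deviation f.
Proof.
rewrite /deviation (reindex_inj rev_ord_inj) /=; apply: eq_bigr => x _.
by rewrite rev_ordK /=; have := ltn_ord x; have := ltn_ord (f x); lia.
Qed.

Lemma deviation0 f : deviation f = 0%N -> total_map f = 1.
Proof.
move/eqP; rewrite sum_nat_eq0 => /forallP d0; apply/ffunP => x; rewrite !ffunE.
by congr Some; apply/val_inj; have /= := d0 x; lia.
Qed.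

Section Subsemigroup.

Variable M : {set PT m.+1}.
Hypothesis mulM : {in M &, forall a b, a * b \in M}.
Hypothesis gammaM : gamma m.+1 \in M.
Hypothesis sJM : Jrank m.+1 :&: POD m.+1 \subset M.

Let eltM r l s : elt r l s \in M.
Proof. by apply: (subsetP sJM); rewrite inE elt_Jrank elt_POD. Qed.

Let oneM : 1 \in M.
Proof. by rewrite -(gamma_invol m.+1) mulM. Qed.

(** Induction on the deviation.  If no point is moved up but some point is moved
down, conjugation by the reflection leads to the first case. *)
Lemma total_map_generated f :
  {homo f : x y / x <= y >-> x <= y} -> total_map f \in M.
Proof.
have [N] := ubnP (deviation f); elim: N f => // N IHN f ltN fm.
have up (g : 'I_m.+1 -> 'I_m.+1) (x : 'I_m.+1) :
    {homo g : x y / x <= y >-> x <= y} -> deviation g <= N -> x < g x ->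
  total_map g \in M.
  move=> gm leN /(lower_one_value gm)[g' [gm' ltg'] [r [l [s ->]]]].
  by rewrite mulM // IHN //; lia.
have [/existsP[x /up] | /existsPn Nup] := boolP [exists x : 'I_m.+1, x < f x]; first exact.
have [/existsP[x ltx] | /existsPn Ndn] := boolP [exists x : 'I_m.+1, f x < x].
  have -> : total_map f =
      gamma _ * total_map (fun x => rev_ord (f (rev_ord x))) * gamma _.
    by rewrite total_map_rev !mulgA gamma_invol mul1g gammaK.
  apply/mulM/gammaM/mulM => //; apply: (up _ (rev_ord x)).
  - by move=> y z leyz /=; have := fm (rev_ord z) (rev_ord y); rewrite /=; lia.
  - by rewrite deviation_rev.
  - by rewrite rev_ordK /=; have := ltn_ord x; lia.
rewrite deviation0 //; rewrite /deviation big1 // => x _.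
by have := Nup x; have := Ndn x; lia.
Qed.

(** A partial identity is a product of partial identities that leave out a single
point; these are the [elt (inl i) i false]. *)
Lemma partial_one_generated D :
  partial_one D \in M.
Proof.
have [N] := ubnP #|~: D|; elim: N D => // N IHN D ltN.
have [DT|[i]] := set_0Vmem (~: D).
  rewrite (_ : partial_one D = 1) //; apply/ffunP => x; rewrite !ffunE.
  by rewrite -[D]setCK DT setC0 inE.
rewrite inE => NDi.
have /IHN/mulM/(_ (eltM (inl i) i false)) : #|~: (i |: D)| < N.
  by move: ltN; rewrite setCU setIC -setDE (cardsD1 i (~: D)) inE NDi; lia.
congr (_ \in M); apply/ffunP => x; rewrite mulE !ffunE in_setU1.
have [->|nexi] /= := eqVneq x i; first by rewrite (negPf NDi) ffunE /= unlift_none.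
case: (x \in D) => //=; rewrite ffunE /=.
by move: nexi; rewrite eq_sym => /unlift_some[y -> ->].
Qed.

Lemma POD_generated : POD m.+1 \subset M.
Proof.
have opM a : order_preserving a -> a \in M.
  move/order_preservingP => am.
  (* The least total order-preserving map that extends a. *)
  pose v y := if a y is Some z then z : nat else 0.
  pose f x : 'I_m.+1 := inord (\max_(y : 'I_m.+1 | y <= x) v y).
  have fE x : f x = \max_(y : 'I_m.+1 | y <= x) v y :> nat.
    rewrite inordK // ltnS; apply/bigmax_leqP => y _; rewrite /v.
    by case: (a y) => // z; rewrite -ltnS.
  have -> : a = partial_one (dom a) * total_map f.
    apply/ffunP => x; rewrite mulE !ffunE inE.
    case ax: (a x) => [z|] //=; rewrite ffunE; congr Some; apply/val_inj.
    rewrite /= fE; apply/eqP; rewrite eqn_leq; apply/andP; split.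
      by apply: (bigmax_sup x) => //; rewrite /v ax.
    apply/bigmax_leqP => y leyx; rewrite /v; case ay: (a y) => [u|] //.
    exact: am ay ax leyx.
  apply/mulM/total_map_generated => [|x y lexy]; first exact: partial_one_generated.
  rewrite !fE; apply/bigmax_leqP => z lezx; apply: (bigmax_sup z) => //.
  exact: leq_trans lexy.
apply/subsetP => a; rewrite inE => /orP[/opM // | /order_reversing_mul_gamma/opM].
by move/mulM/(_ gammaM); rewrite gammaK.
Qed.

End Subsemigroup.

End Generation.

(** * Maximal subsemigroups in coordinates *)

Lemma subsemigroupP (T : finMonoidType) (M : {set T}) :
  reflect (M != set0 /\ {in M &, forall a b, a * b \in M}) (subsemigroup M).
Proof.
apply: (iffP andP) => -[M0 cl]; split=> //.
  by move=> a b aM bM; move/forall_inP: cl => /(_ a aM)/forall_inP/(_ b bM).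
by apply/forall_inP => a aM; apply/forall_inP => b bM; apply: cl.
Qed.

Section Candidates.

Variable m : nat.

Local Notation S := (POD m.+1).
Local Notation J := (Jrank m.+1 :&: POD m.+1).
Local Notation gamma := (gamma m.+1).

Implicit Types (r : kernel_index m) (l : 'I_m.+1) (B : {set 'I_m.+1}).
Implicit Types (a b : PT m.+1) (X M : {set PT m.+1}).

Lemma rev_indexK : involutive (@rev_index m).
Proof. by case=> i /=; rewrite rev_ordK. Qed.

Lemma transverse_rev l r :
  transverse (rev_ord l) (rev_index r) = transverse l r.
Proof.
case: r => i /=; first by rewrite (inj_eq rev_ord_inj).
have := ltn_ord i; have := ltn_ord l; lia.
Qed.

Lemma gamma_notin_Jrank : gamma \notin Jrank m.+1.
Proof. by rewrite inE rank_gamma; lia. Qed.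

Lemma one_notin_Jrank : 1 \notin Jrank m.+1.
Proof. by rewrite inE rank_one; lia. Qed.

Lemma gamma_neq1 : 0 < m -> gamma != 1.
Proof.
by move=> m_gt0; apply/eqP => /ffunP/(_ ord0); rewrite !ffunE => /Some_inj/(congr1 val) /=; lia.
Qed.

Lemma elt_J r l s : elt r l s \in J.
Proof. by rewrite inE elt_Jrank elt_POD. Qed.

Lemma elt_neq_gamma r l s : elt r l s != gamma.
Proof. by apply: contraNneq gamma_notin_Jrank => <-; apply: elt_Jrank. Qed.

(** A product of rank m has a unit factor, or both factors have rank m and their
product is given by the coordinates. *)
Lemma mul_Jrank_cases a b : a \in S -> b \in S -> a * b \in Jrank m.+1 ->
  [\/ a = 1 \/ a = gamma, b = 1 \/ b = gamma
    | exists r l s r' l' s',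
        [/\ a = elt r l s, b = elt r' l' s' & transverse l r']].
Proof.
move=> aS bS abJ; have := abJ; rewrite inE => /eqP /= rk.
have := rank_mull a b; have := rank_mulr a b; rewrite rk.
have := rank_le_n a; have := rank_le_n b.
rewrite leq_eqVlt => /orP[/eqP/(POD_full_rank bS) ub _ _ _ | ltb].
  by constructor 2.
rewrite leq_eqVlt => /orP[/eqP/(POD_full_rank aS) ua _ _ | lta].
  by constructor 1.
move=> leb lea.
have /eltP[r [l [s def_a]]] : a \in J by rewrite inE aS andbT inE; lia.
have /eltP[r' [l' [s' def_b]]] : b \in J by rewrite inE bS andbT inE; lia.
constructor 3; exists r, l, s, r', l', s'; split=> //.
by move: abJ; rewrite def_a def_b; apply: contraTT => /elt_mul_lower; apply.
Qed.

(** A set with all elements whose rank is not m is closed under products as soon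
as its elements of rank m are closed under reflection on either side and under
the products that stay in J. *)
Lemma subsemigroup_criterion X :
    X \subset S -> S :\: Jrank m.+1 \subset X ->
    (forall r l s, elt r l s \in X -> elt (rev_index r) l (~~ s) \in X) ->
    (forall r l s, elt r l s \in X -> elt r (rev_ord l) (~~ s) \in X) ->
    (forall r l s r' l' s', elt r l s \in X -> elt r' l' s' \in X ->
       transverse l r' -> elt r l' (s (+) s') \in X) ->
  subsemigroup X.
Proof.
move=> /subsetP sXS /subsetP sIX Xl Xr Xm; apply/subsemigroupP; split.
  by apply/set0Pn; exists 1; apply: sIX; rewrite inE one_notin_Jrank one_POD.
move=> a b aX bX; have [aS bS] := (sXS a aX, sXS b bX).
have [abJ | NabJ] := boolP (a * b \in Jrank m.+1); last first.
  by apply: sIX; rewrite inE NabJ mul_POD.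
case: (mul_Jrank_cases aS bS abJ) => [[]ea|[]eb|[r [l [s [r' [l' [s' [ea eb lr']]]]]]]].
- by rewrite ea mul1g.
- rewrite ea in abJ *; have /eltP[r [l [s eqb]]] : gamma * b \in J.
    by apply/setIP; rewrite mul_POD ?gamma_POD.
  have eb : b = elt (rev_index r) l (~~ s) by rewrite -gamma_elt -eqb gammaVK.
  by move: bX; rewrite eqb eb => /Xl; rewrite rev_indexK negbK.
- by rewrite eb mulg1.
- rewrite eb in abJ *; have /eltP[r [l [s eqa]]] : a * gamma \in J.
    by apply/setIP; rewrite mul_POD ?gamma_POD.
  have ea : a = elt r (rev_ord l) (~~ s) by rewrite -elt_gamma -eqa gammaK.
  by move: aX; rewrite eqa ea => /Xr; rewrite rev_ordK negbK.
by move: aX bX; rewrite ea eb elt_mul // => aX bX; apply: Xm aX bX lr'.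
Qed.

(** The elements of rank m whose kernel has index r. *)
Definition R_class r := [set elt r p.1 p.2 | p : 'I_m.+1 * bool].

(** The subsemigroup that misses the R-class of r and its reflection. *)
Definition R_complement r := S :\: (R_class r :|: R_class (rev_index r)).

(** For some l in B, following an element whose image misses l by an element with
kernel r gives an element of rank m. *)
Definition blocked B r := [exists l in B, transverse l r].

(** The subsemigroup whose elements of rank m are those whose image misses a point
of B, together with those whose kernel admits no transverse point in B. *)
Definition LR_union B :=
  (S :\: Jrank m.+1) :|:
  [set a | [exists r, exists l, exists s,
     (a == elt r l s) && ((l \in B) || ~~ blocked B r)]].

Lemma R_classP r a : reflect (exists l s, a = elt r l s) (a \in R_class r).
Proof.
apply: (iffP imsetP) => [[[l s] _ ->] | [l [s ->]]]; first by exists l, s.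
by exists (l, s).
Qed.

Lemma elt_R_class r l s r' : (elt r l s \in R_class r') = (r == r').
Proof.
apply/R_classP/eqP => [[l' [s' /elt_index_inj]] // | ->].
by exists l, s.
Qed.

Lemma elt_R_complement r l s r' :
  (elt r l s \in R_complement r') = (r != r') && (r != rev_index r').
Proof. by rewrite in_setD in_setU !elt_R_class elt_POD negb_or andbT. Qed.

Lemma elt_LR_union r l s B :
  (elt r l s \in LR_union B) = (l \in B) || ~~ blocked B r.
Proof.
rewrite in_setU in_setD elt_Jrank /= inE; apply/existsP/idP => [[r' /existsP[l']] | Bl].
  move=> /existsP[s' /andP[/eqP e]].
  by rewrite (elt_index_inj e) (elt_im_inj e).
by exists r; apply/existsP; exists l; apply/existsP; exists s; rewrite eqxx.
Qed.

Lemma R_class_sub r : R_class r \subset J.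
Proof. by apply/subsetP => _ /R_classP[l [s ->]]; apply: elt_J. Qed.

Lemma sub_R_complement r : S :\: Jrank m.+1 \subset R_complement r.
Proof.
rewrite setDS // subUset.
by rewrite !(subset_trans (R_class_sub _)) ?subsetIl.
Qed.

Lemma sub_LR_union B : S :\: Jrank m.+1 \subset LR_union B.
Proof. exact: subsetUl. Qed.

Lemma LR_union_sub B : LR_union B \subset S.
Proof.
rewrite subUset subsetDl; apply/subsetP => a; rewrite inE.
move=> /existsP[r /existsP[l /existsP[s /andP[/eqP-> _]]]]; exact: elt_POD.
Qed.

(** Invariance under the reflection of the chain. *)
Definition rev_closed B := [forall l in B, rev_ord l \in B].

Lemma rev_closedP B : rev_closed B -> forall l, (rev_ord l \in B) = (l \in B).
Proof.
move=> /forall_inP revB l; apply/idP/idP => /revB //.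
by rewrite rev_ordK.
Qed.

Lemma blocked_rev B r : rev_closed B -> blocked B (rev_index r) = blocked B r.
Proof.
move=> revB; apply/exists_inP/exists_inP => -[l Bl lr]; exists (rev_ord l);
  by rewrite ?(rev_closedP revB) // -transverse_rev ?rev_ordK ?rev_indexK.
Qed.

Lemma subsemigroup_R_complement r : subsemigroup (R_complement r).
Proof.
apply: subsemigroup_criterion (sub_R_complement r) _ _ _; first exact: subsetDl.
- move=> r' l s; rewrite !elt_R_complement (inv_eq rev_indexK).
  by rewrite (inj_eq (inv_inj rev_indexK)) andbC.
- by move=> r' l s; rewrite !elt_R_complement.
- by move=> r' l s r'' l' s'; rewrite !elt_R_complement.
Qed.

Lemma subsemigroup_LR_union B : rev_closed B -> subsemigroup (LR_union B).
Proof.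
move=> revB; apply: subsemigroup_criterion (sub_LR_union B) _ _ _.
- exact: LR_union_sub.
- by move=> r l s; rewrite !elt_LR_union blocked_rev.
- by move=> r l s; rewrite !elt_LR_union (rev_closedP revB).
- move=> r l s r' l' s'; rewrite !elt_LR_union.
  case/orP=> [Bl|->]; last by rewrite orbT.
  case/orP=> [->|] //; rewrite negb_exists => /forallP/(_ l).
  by rewrite Bl /= => /negPf->.
Qed.

Lemma subsemigroup_POD_gamma : 0 < m -> subsemigroup (S :\ gamma).
Proof.
move=> /gamma_neq1 gamma_neq1; apply/subsemigroupP; split.
  by apply/set0Pn; exists 1; rewrite in_setD1 eq_sym gamma_neq1 one_POD.
move=> a b /setD1P[nea aS] /setD1P[neb bS]; apply/setD1P; split; last exact: mul_POD.
apply/eqP => ab; have rk := rank_gamma m.+1; rewrite -ab in rk.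
have rka : rank a = m.+1.
  by apply/eqP; rewrite eqn_leq rank_le_n -{1}rk rank_mull.
have rkb : rank b = m.+1.
  by apply/eqP; rewrite eqn_leq rank_le_n -{1}rk rank_mulr.
case: (POD_full_rank aS rka) nea ab => ->; rewrite ?eqxx // => _.
case: (POD_full_rank bS rkb) neb => ->; rewrite ?eqxx // => _.
by rewrite mulg1 => /esym/eqP; rewrite (negPf gamma_neq1).
Qed.

Lemma gamma_mem X : S :\: Jrank m.+1 \subset X -> gamma \in X.
Proof.
by move/subsetP; apply; rewrite in_setD gamma_notin_Jrank gamma_POD.
Qed.

Lemma proper_R_complement r : R_complement r \proper S.
Proof.
rewrite properE subsetDl; apply/subsetPn; exists (elt r ord0 false).
  exact: elt_POD.
by rewrite elt_R_complement eqxx.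
Qed.

Lemma proper_LR_union B : B != set0 -> B != setT -> LR_union B \proper S.
Proof.
move=> /set0Pn[b Bb] BT; have /subsetPn[l _ NBl] : ~~ (setT \subset B).
  by rewrite subTset.
rewrite properE LR_union_sub; apply/subsetPn.
exists (elt (inl b) l false); first exact: elt_POD.
rewrite elt_LR_union (negPf NBl) negbK; apply/exists_inP; exists b => //=.
Qed.

Lemma proper_POD_gamma : S :\ gamma \proper S.
Proof. by rewrite properD1 ?gamma_POD. Qed.

(** The three families of maximal subsemigroups, in coordinates. *)
Definition candidate X :=
  [\/ X = S :\ gamma,
      exists B, [/\ B != set0, B != setT, rev_closed B & X = LR_union B]
    | exists r, X = R_complement r].

Lemma candidate_proper X : 0 < m -> candidate X -> subsemigroup X /\ X \proper S.
Proof.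
move=> m_gt0 [-> | [B [B0 BT revB ->]] | [r ->]].
- by split; [exact: subsemigroup_POD_gamma | exact: proper_POD_gamma].
- by split; [exact: subsemigroup_LR_union | exact: proper_LR_union].
- by split; [exact: subsemigroup_R_complement | exact: proper_R_complement].
Qed.

(** The reflection fixes the middle point if m + 1 is odd, and otherwise the kernel
that identifies the two middle points. *)
Lemma middle_ex : (exists l, rev_ord l = l) \/
  (exists r l, rev_index r = r /\ transverse l r).
Proof.
have [om|em] := boolP (odd m); [right|left].
  have lti : m./2 < m by lia.
  have ltl : m./2 < m.+1 by lia.
  exists (inr (Ordinal lti)), (Ordinal ltl); rewrite /= eqxx; split=> //.
  congr inr; apply/val_inj => /=; lia.
have ltl : m./2 < m.+1 by lia.
exists (Ordinal ltl); apply/val_inj => /=; lia.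
Qed.

(** Every proper subsemigroup is contained in a candidate. *)
Lemma proper_sub_candidate M : subsemigroup M -> M \proper S ->
  exists2 X, candidate X & M \subset X.
Proof.
move=> /subsemigroupP[_ clM] ltMS; have sMS := proper_sub ltMS.
have [gM | NgM] := boolP (gamma \in M); last first.
  exists (S :\ gamma); first by constructor 1.
  by rewrite subsetD1 sMS.
have subX X : S :\: Jrank m.+1 \subset X ->
    (forall r l s, elt r l s \in M -> elt r l s \in X) -> M \subset X.
  move=> /subsetP sIX sX; apply/subsetP => a aM; have aS := subsetP sMS a aM.
  have [aJ | NaJ] := boolP (a \in J); last first.
    by apply: sIX; move: NaJ; rewrite !in_setI in_setD aS !andbT.
  by have /eltP[r [l [s ea]]] := aJ; move: aM; rewrite ea; apply: sX.
(* The images that occur in M together with the kernel r. *)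
pose C r := [set l | [exists s, elt r l s \in M]].
have CP r l : reflect (exists s, elt r l s \in M) (l \in C r).
  by rewrite inE; apply: existsP.
have Crev r l : l \in C r -> rev_ord l \in C r.
  move=> /CP[s rlM]; apply/CP; exists (~~ s).
  by rewrite -elt_gamma clM.
have Crev_index r : C r \subset C (rev_index r).
  apply/subsetP => l /CP[s rlM]; apply/CP; exists (~~ s).
  by rewrite -gamma_elt clM.
have Ctrans r l r' l' : l \in C r -> transverse l r' -> l' \in C r' -> l' \in C r.
  move=> /CP[s rlM] lr' /CP[s' rlM']; apply/CP; exists (s (+) s').
  by rewrite -(elt_mul r s l' s' lr') clM.
have [/existsP[r /eqP Cr0] | /existsPn Cn0] := boolP [exists r, C r == set0].
  exists (R_complement r); first by constructor 3; exists r.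
  apply: subX (sub_R_complement r) _ => r' l s rlM; rewrite elt_R_complement.
  have: l \in C r' by apply/CP; exists s.
  move=> Cl; apply/andP; split; apply/eqP => e.
    by move: Cl; rewrite e Cr0 inE.
  by move: (subsetP (Crev_index _) l Cl); rewrite e rev_indexK Cr0 inE.
have [/existsP[r CrT] | /existsPn CT] := boolP [exists r, C r != setT].
  exists (LR_union (C r)).
    constructor 2; exists (C r); split=> //.
    by apply/forall_inP => l; apply: Crev.
  apply: subX (sub_LR_union _) _ => r' l s rlM; rewrite elt_LR_union.
  rewrite orbC -implybE; apply/implyP => /exists_inP[b Cb br'].
  by apply: Ctrans Cb br' _; apply/CP; exists s.
have {}CT r l : exists s, elt r l s \in M.
  by apply/CP; have := CT r; rewrite negbK => /eqP->; rewrite inE.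
(* Every H-class of J meets M; the fixed point of the reflection supplies both
   signs. *)
have allM r l s : elt r l s \in M.
  case: middle_ex => [[l0 rl0] | [r0 [l0 [rr0 l0r0]]]].
    have [s0 rM] := CT r l0; have [s1 lM] := CT (inl l0) l.
    have {}rM s' : elt r l0 s' \in M.
      have [-> //|->] : s' = s0 \/ s' = ~~ s0 by case: (s'); case: (s0); auto.
      by rewrite -{1}rl0 -elt_gamma clM.
    have := clM _ _ (rM (s (+) s1)) lM.
    by rewrite elt_mul ?addbK //= eqxx.
  have [s0 rM] := CT r l0; have [s1 lM] := CT r0 l.
  have {}lM s' : elt r0 l s' \in M.
    have [-> //|->] : s' = s1 \/ s' = ~~ s1 by case: (s'); case: (s1); auto.
    by rewrite -{1}rr0 -gamma_elt clM.
  have := clM _ _ rM (lM (s0 (+) s)).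
  by rewrite elt_mul // addKb.
case/negP: (proper_subn ltMS); apply: POD_generated => //.
by apply/subsetP => _ /eltP[r [l [s ->]]].
Qed.

(** Elements with kernel [inl b'], for b' in B', lie in the right-hand set only if
the point missing from their image is in B'; elements with kernel [inl l], for
l outside B, all lie in the left-hand set. *)
Lemma LR_union_subset_eq B B' : B' != set0 -> B' != setT ->
  LR_union B \subset LR_union B' -> B = B'.
Proof.
move=> /set0Pn[b' Bb'] BT' /subsetP sub.
apply/eqP; rewrite eqEsubset; apply/andP; split; apply/subsetP => l lB.
  have := sub (elt (inl b') l false); rewrite !elt_LR_union lB => /(_ isT).
  case/orP => // /exists_inP[]; by exists b' => /=.
have /subsetPn[c _ NBc] : ~~ (setT \subset B') by rewrite subTset.
apply: contraT => NBl.
have := sub (elt (inl l) c false); rewrite !elt_LR_union (negPf NBc) /=.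
rewrite [~~ blocked B _](_ : _ = true) ?orbT; last first.
  by apply/exists_inP => -[k Bk /eqP e]; rewrite -e Bk in NBl.
by move/(_ isT)/exists_inP => []; exists l => /=.
Qed.

Lemma LR_union_notsub_R_complement B r : B != set0 -> ~~ (LR_union B \subset R_complement r).
Proof.
move=> /set0Pn[b Bb]; apply/subsetPn; exists (elt r b false).
  by rewrite elt_LR_union Bb.
by rewrite elt_R_complement eqxx.
Qed.

Lemma transverse_inr_ex l : 0 < m -> exists i, transverse l (inr i).
Proof.
move=> m_gt0; have [ltlm | lelm] := ltnP l m; first by exists (Ordinal ltlm); rewrite /= eqxx.
have ltm : m.-1 < m by lia.
by exists (Ordinal ltm) => /=; have := ltn_ord l; lia.
Qed.

Lemma R_complement_notsub_LR B r : 0 < m -> B != set0 -> B != setT ->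
  ~~ (R_complement r \subset LR_union B).
Proof.
move=> m_gt0 /set0Pn[b Bb] BT.
have /subsetPn[l _ NBl] : ~~ (setT \subset B) by rewrite subTset.
have [r' [br' ner ner']] : exists r', [/\ transverse b r', r' != r & r' != rev_index r].
  have [i bi] := transverse_inr_ex b m_gt0.
  (* Reflection preserves the two sorts of kernel, so one of each is tried. *)
  by case: r => j; [exists (inr i) | exists (inl b)]; split=> //=.
apply/subsetPn; exists (elt r' l false).
  by rewrite elt_R_complement ner.
by rewrite elt_LR_union (negPf NBl) negbK; apply/exists_inP; exists b.
Qed.

Lemma R_complement_subset r r' : R_complement r \subset R_complement r' ->
  r = r' \/ r = rev_index r'.
Proof.
move=> /subsetP/(_ (elt r' ord0 false)); rewrite !elt_R_complement eqxx /=.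
case: (r' =P r) => [-> _ | _ /=]; first by left.
case: (r' =P _) => [-> _ | _ /(_ isT) //]; by right; rewrite rev_indexK.
Qed.

Lemma R_complement_rev r : R_complement (rev_index r) = R_complement r.
Proof. by rewrite /R_complement rev_indexK setUC. Qed.

Lemma gamma_LR_union B : gamma \in LR_union B.
Proof. exact/gamma_mem/sub_LR_union. Qed.

Lemma gamma_R_complement r : gamma \in R_complement r.
Proof. exact/gamma_mem/sub_R_complement. Qed.

(** No candidate is properly contained in another one. *)
Lemma candidate_antichain X Y :
  0 < m -> candidate X -> candidate Y -> X \subset Y -> X = Y.
Proof.
move=> m_gt0.
have gammaN (Z : {set PT m.+1}) : gamma \in Z -> Z \subset S :\ gamma -> X = Y.
  by move=> gZ /subsetP sub; have := sub _ gZ; rewrite in_setD1 eqxx.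
have Ngamma (Z : {set PT m.+1}) :
    Z \proper S -> gamma \in Z -> S :\ gamma \subset Z -> X = Y.
  move=> /properP[_ [a aS NaZ]] gZ /subsetP/(_ a).
  rewrite in_setD1 aS andbT (negPf NaZ); case: eqP => [e|_ /(_ isT)] //.
  by rewrite e gZ in NaZ.
move=> cX cY; have [_ pX] := candidate_proper m_gt0 cX.
have [_ pY] := candidate_proper m_gt0 cY.
case: cX pX gammaN Ngamma => [-> | [B [B0 BT revB ->]] | [r ->]] pX gammaN Ngamma;
  case: cY pY gammaN Ngamma => [-> | [B' [B0' BT' revB' ->]] | [r' ->]] pY gammaN Ngamma //.
- exact/Ngamma/gamma_LR_union.
- exact/Ngamma/gamma_R_complement.
- exact/gammaN/gamma_LR_union.
- by move/(LR_union_subset_eq B0' BT') ->.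
- by move=> sub; case/negP: (LR_union_notsub_R_complement r' B0).
- exact/gammaN/gamma_R_complement.
- by move=> sub; case/negP: (R_complement_notsub_LR r m_gt0 B0' BT').
- by case/R_complement_subset => ->; rewrite ?R_complement_rev.
Qed.

(** As every proper subsemigroup is below a candidate and the candidates form an
antichain of proper subsemigroups, they are the maximal ones. *)
Lemma maximal_candidate M : 0 < m -> maximal_subsemigroup S M <-> candidate M.
Proof.
move=> m_gt0; split=> [/maxsetP[/andP[sgM pM] maxM] | cM].
  have [X cX sMX] := proper_sub_candidate sgM pM.
  by rewrite -(maxM X) //; have [-> ->] := candidate_proper m_gt0 cX.
have [sgM pM] := candidate_proper m_gt0 cM.
apply/maxsetP; rewrite sgM pM; split=> // X /andP[sgX pX] sMX.
have [Y cY sXY] := proper_sub_candidate sgX pX.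
have eMY := candidate_antichain m_gt0 cM cY (subset_trans sMX sXY).
by apply/eqP; rewrite eqEsubset sMX andbT eMY.
Qed.

End Candidates.

(** * Green's relations *)

Section Green.

Variables (n : nat).
Implicit Types a b : PT n.
Local Notation S := (POD n).

(** As S is a submonoid, equal principal right ideals means that each generator is
a right multiple of the other. *)
Lemma greenRP a b :
  reflect ((exists2 x, x \in S & b = a * x) /\ (exists2 y, y \in S & a = b * y))
    (greenR S a b).
Proof.
have sub c d y : y \in S -> c = d * y -> [set c * x | x in S] \subset [set d * x | x in S].
  move=> yS ->; apply/subsetP => _ /imsetP[x xS ->].
  by apply/imsetP; exists (y * x); rewrite ?mul_POD ?mulgA.
have mem c : c \in [set c * x | x in S].
  by apply/imsetP; exists 1; rewrite ?one_POD ?mulg1.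
apply: (iffP eqP) => [e | [[x xS eb] [y yS ea]]]; last first.
  by apply/eqP; rewrite eqEsubset (sub _ _ _ yS ea) (sub _ _ _ xS eb).
split.
  by have: b \in [set a * x | x in S]; [rewrite e | case/imsetP => x; exists x].
by have: a \in [set b * x | x in S]; [rewrite -e | case/imsetP => x; exists x].
Qed.

Lemma greenLP a b :
  reflect ((exists2 x, x \in S & b = x * a) /\ (exists2 y, y \in S & a = y * b))
    (greenL S a b).
Proof.
have sub c d y : y \in S -> c = y * d -> [set x * c | x in S] \subset [set x * d | x in S].
  move=> yS ->; apply/subsetP => _ /imsetP[x xS ->].
  by apply/imsetP; exists (x * y); rewrite ?mul_POD ?mulgA.
have mem c : c \in [set x * c | x in S].
  by apply/imsetP; exists 1; rewrite ?one_POD ?mul1g.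
apply: (iffP eqP) => [e | [[x xS eb] [y yS ea]]]; last first.
  by apply/eqP; rewrite eqEsubset (sub _ _ _ yS ea) (sub _ _ _ xS eb).
split.
  by have: b \in [set x * a | x in S]; [rewrite e | case/imsetP => x; exists x].
by have: a \in [set x * b | x in S]; [rewrite -e | case/imsetP => x; exists x].
Qed.

Lemma greenJP a b :
  reflect
    ((exists x y, [/\ x \in S, y \in S & b = x * a * y]) /\
     (exists x y, [/\ x \in S, y \in S & a = x * b * y]))
    (greenJ S a b).
Proof.
have sub c d x y : x \in S -> y \in S -> c = x * d * y ->
    [set u * c * v | u in S, v in S] \subset [set u * d * v | u in S, v in S].
  move=> xS yS ->; apply/subsetP => _ /imset2P[u v uS vS ->].
  by apply/imset2P; exists (u * x) (y * v); rewrite ?mul_POD ?mulgA.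
have mem c : c \in [set u * c * v | u in S, v in S].
  by apply/imset2P; exists 1 1; rewrite ?one_POD ?mulg1 ?mul1g.
apply: (iffP eqP) => [e | [[x [y [xS yS eb]]] [u [v [uS vS ea]]]]]; last first.
  by apply/eqP; rewrite eqEsubset (sub _ _ _ _ uS vS ea) (sub _ _ _ _ xS yS eb).
split.
  have /imset2P[x y xS yS eb] : b \in [set u * a * v | u in S, v in S] by rewrite e.
  by exists x, y.
have /imset2P[x y xS yS eb] : a \in [set u * b * v | u in S, v in S] by rewrite -e.
by exists x, y.
Qed.

Lemma greenJ_rank a b : greenJ S a b -> rank a = rank b.
Proof.
have le x c y : rank (x * c * y) <= rank c.
  exact: leq_trans (rank_mull _ _) (rank_mulr _ _).
move=> /greenJP[[x [y [_ _ eb]]] [u [v [_ _ ea]]]]; apply/eqP.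
by rewrite eqn_leq {1}ea {3}eb !le.
Qed.

End Green.

(** * Types of the maximal subsemigroups *)

Section Types.

Variable m : nat.

Local Notation S := (POD m.+1).
Local Notation J := (Jrank m.+1 :&: POD m.+1).
Local Notation gamma := (gamma m.+1).

Implicit Types (r : kernel_index m) (l : 'I_m.+1) (B : {set 'I_m.+1}).
Implicit Types (a b : PT m.+1) (X M : {set PT m.+1}).

(** The elements of rank m whose image misses l. *)
Definition L_class l := [set elt p.1 l p.2 | p : kernel_index m * bool].

Lemma L_classP l a : reflect (exists r s, a = elt r l s) (a \in L_class l).
Proof.
apply: (iffP imsetP) => [[[r s] _ ->] | [r [s ->]]]; first by exists r, s.
by exists (r, s).
Qed.

Lemma elt_L_class r l s l' : (elt r l s \in L_class l') = (l == l').
Proof.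
apply/L_classP/eqP => [[r' [s' /elt_im_inj]] // | ->].
by exists r, s.
Qed.

Lemma L_class_sub l : L_class l \subset J.
Proof. by apply/subsetP => _ /L_classP[r [s ->]]; apply: elt_J. Qed.

Lemma elt_mulr_R_class r l s x : x \in S -> elt r l s * x \in Jrank m.+1 ->
  elt r l s * x \in R_class r.
Proof.
have Nunit := @elt_neq_gamma m; have JN := one_notin_Jrank m.
move=> xS rxJ; case: (mul_Jrank_cases (elt_POD r l s) xS rxJ).
- by case=> e; [move: JN; rewrite -e elt_Jrank | move: (Nunit r l s); rewrite -e eqxx].
- by case=> ->; rewrite ?mulg1 ?elt_gamma elt_R_class.
move=> [r0 [l0 [s0 [r1 [l1 [s1 [e -> tr]]]]]]].
by rewrite e elt_mul // elt_R_class (elt_index_inj e).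
Qed.

Lemma elt_mull_L_class r l s x : x \in S -> x * elt r l s \in Jrank m.+1 ->
  x * elt r l s \in L_class l.
Proof.
have Nunit := @elt_neq_gamma m; have JN := one_notin_Jrank m.
move=> xS rxJ; case: (mul_Jrank_cases xS (elt_POD r l s) rxJ).
- by case=> ->; rewrite ?mul1g ?gamma_elt elt_L_class.
- by case=> e; [move: JN; rewrite -e elt_Jrank | move: (Nunit r l s); rewrite -e eqxx].
move=> [r0 [l0 [s0 [r1 [l1 [s1 [-> e tr]]]]]]].
by rewrite e elt_mul // elt_L_class (elt_im_inj e).
Qed.

Lemma rank_elt r l s : rank (elt r l s) = m.
Proof. by have := elt_Jrank r l s; rewrite inE => /eqP. Qed.

Lemma rank_J a : a \in J = (a \in S) && (rank a == m).
Proof. by rewrite in_setI andbC [a \in Jrank _]inE. Qed.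

Lemma greenR_class r l s : [set b in S | greenR S (elt r l s) b] = R_class r.
Proof.
apply/setP => b; rewrite in_set.
apply/andP/R_classP => [[bS /greenRP[[x xS eb] [y yS ea]]] | [l' [s' ->]]].
  have rb : rank b = m.
    apply/eqP; rewrite eqn_leq {1}eb (leq_trans (rank_mull _ _)) ?rank_elt //.
    by rewrite -[X in X <= _](rank_elt r l s) ea rank_mull.
  by apply/R_classP; rewrite eb elt_mulr_R_class // -eb inE rb.
split; first exact: elt_POD.
have gen l1 s1 l2 s2 : exists2 x, x \in S & elt r l1 s1 = elt r l2 s2 * x.
  exists (elt (inl l2) l1 (s2 (+) s1)); first exact: elt_POD.
  by rewrite elt_mul ?addKb //= eqxx.
by apply/greenRP; split; apply: gen.
Qed.

Lemma greenL_class r l s : [set b in S | greenL S (elt r l s) b] = L_class l.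
Proof.
apply/setP => b; rewrite in_set.
apply/andP/L_classP => [[bS /greenLP[[x xS eb] [y yS ea]]] | [r' [s' ->]]].
  have rb : rank b = m.
    apply/eqP; rewrite eqn_leq {1}eb (leq_trans (rank_mulr _ _)) ?rank_elt //.
    by rewrite -[X in X <= _](rank_elt r l s) ea rank_mulr.
  by apply/L_classP; rewrite eb elt_mull_L_class // -eb inE rb.
split; first exact: elt_POD.
have gen r1 s1 r2 s2 : exists2 x, x \in S & elt r1 l s1 = x * elt r2 l s2.
  have [l' tr] := transverse_ex r2.
  exists (elt r1 l' (s1 (+) s2)); first exact: elt_POD.
  by rewrite elt_mul ?addbK.
by apply/greenLP; split; apply: gen.
Qed.

Lemma greenJ_class r l s : [set b in S | greenJ S (elt r l s) b] = J.
Proof.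
apply/setP => b; rewrite in_set.
apply/andP/idP => [[bS /greenJ_rank] | bJ].
  by rewrite rank_elt rank_J bS => <- /=.
have bS : b \in S by case/setIP: bJ.
split=> //; have /eltP[r' [l' [s' ->]]] := bJ.
have gen r1 l1 s1 r2 l2 s2 :
    exists x y, [/\ x \in S, y \in S & elt r1 l1 s1 = x * elt r2 l2 s2 * y].
  have [l0 tr] := transverse_ex r2.
  exists (elt r1 l0 s1), (elt (inl l2) l1 s2); rewrite !elt_POD; split=> //.
  by rewrite !elt_mul ?addbK //= eqxx.
by apply/greenJP; split; apply: gen.
Qed.

Lemma R_classesE : classes_in (@greenR (PT m.+1)) S J = [set R_class r | r : kernel_index m].
Proof.
apply/setP => K; apply/imsetP/imsetP => [[_ /eltP[r [l [s ->]]] ->] | [r _ ->]].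
  by exists r => //; exact: greenR_class.
by exists (elt r ord0 false); rewrite ?elt_J ?greenR_class.
Qed.

Lemma L_classesE : classes_in (@greenL (PT m.+1)) S J = [set L_class l | l : 'I_m.+1].
Proof.
apply/setP => K; apply/imsetP/imsetP => [[_ /eltP[r [l [s ->]]] ->] | [l _ ->]].
  by exists l => //; exact: greenL_class.
by exists (elt (inl ord0) l false); rewrite ?elt_J ?greenL_class.
Qed.

(** J is a regular J-class, so that a subsemigroup whose complement is contained in
J arises from it. *)
Lemma arises_from_J M : S :\: M \subset J -> arises_from S M J.
Proof.
move=> sMJ; split=> //.
  by apply/imsetP; exists (elt (inl ord0) ord0 false); rewrite ?elt_POD ?greenJ_class.
apply/forall_inP => _ /eltP[r [l [s ->]]]; have [l' tr] := transverse_ex r.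
(* With l' transverse to r, this is a generalized inverse of elt r l s. *)
apply/existsP; exists (elt (inl l) l' s); rewrite elt_POD /=.
by rewrite !elt_mul ?addbK //= ?eqxx // addbb addFb eqxx.
Qed.

Lemma setD_sub_J M : S :\: Jrank m.+1 \subset M -> S :\: M \subset J.
Proof.
move=> /subsetP sM; apply/subsetP => a /setDP[aS NaM]; rewrite in_setI aS andbT.
by apply: contraR NaM => NaJ; apply: sM; rewrite in_setD NaJ.
Qed.

Lemma setIJ_eq (X Y : {set PT m.+1}) : Y \subset J ->
  (forall r l s, (elt r l s \in X) = (elt r l s \in Y)) -> X :&: J = Y.
Proof.
move=> sYJ eXY; apply/setP => a; have [aJ | NaJ] := boolP (a \in J).
  by rewrite in_setI aJ andbT; have /eltP[r [l [s ->]]] := aJ.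
rewrite in_setI (negPf NaJ) andbF; apply/esym/negbTE.
exact: contra (subsetP sYJ a) NaJ.
Qed.

Lemma cover_imset_sub (I : finType) (P : {set I}) (F : I -> {set PT m.+1}) :
  (forall i, F i \subset J) -> cover [set F i | i in P] \subset J.
Proof. by move=> sF; apply/bigcupsP => _ /imsetP[i _ ->]. Qed.

Lemma elt_cover_R r l s (P : {set kernel_index m}) :
  (elt r l s \in cover [set R_class r' | r' in P]) = (r \in P).
Proof.
apply/bigcupP/idP => [[_ /imsetP[r' Pr' ->]] | Pr].
  by rewrite elt_R_class => /eqP->.
by exists (R_class r); rewrite ?elt_R_class // imset_f.
Qed.

Lemma elt_cover_L r l s B :
  (elt r l s \in cover [set L_class l' | l' in B]) = (l \in B).
Proof.
apply/bigcupP/idP => [[_ /imsetP[l' Bl' ->]] | Bl].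
  by rewrite elt_L_class => /eqP->.
by exists (L_class l); rewrite ?elt_L_class // imset_f.
Qed.

Lemma type_M5_POD_gamma : 0 < m -> type_M5 S (S :\ gamma).
Proof.
move=> m_gt0; have one_class : [set b in S | greenJ S 1 b] = [set 1; gamma].
  apply/setP => b; rewrite in_set in_set2.
  apply/andP/orP => [[bS /greenJ_rank] | e].
    by rewrite rank_one => /esym/(POD_full_rank bS)[]->; rewrite eqxx; auto.
  have bS : b \in S by case: e => /eqP->; rewrite ?one_POD ?gamma_POD.
  have bb : b * b = 1 by case: e => /eqP->; rewrite ?mulg1 ?gamma_invol.
  split=> //; apply/greenJP; split; [exists 1, b | exists b, 1];
  by rewrite one_POD ?mul1g ?bb ?mulg1.
exists [set 1; gamma]; first split.
- by apply/imsetP; exists 1; rewrite ?one_POD.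
- apply/forall_inP => a; rewrite in_set2 => ea; apply/existsP; exists a.
  by case/orP: ea => /eqP->; rewrite ?one_POD ?gamma_POD ?gamma_invol ?mul1g eqxx.
- by rewrite setDDr setDv set0U; apply/subsetP => a /setIP[_ /set1P->]; rewrite in_set2 eqxx orbT.
move=> _ /imsetP[a aU ->]; apply/set0Pn; exists 1.
rewrite !in_setI in_setD1 in_set2 in_set eqxx one_POD eq_sym gamma_neq1 //=.
have aS : a \in S by case/set2P: aU => ->; rewrite ?one_POD ?gamma_POD.
have aa : a * a = 1 by case/set2P: aU => ->; rewrite ?mulg1 ?gamma_invol.
by apply/andP; split; [apply/greenLP | apply/greenRP];
  split; exists a; rewrite ?aa ?mul1g ?mulg1.
Qed.

Lemma type_M2_LR_union B : B != set0 -> B != setT -> type_M2 S (LR_union B).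
Proof.
move=> /set0Pn[b Bb] BT.
have /subsetPn[c _ NBc] : ~~ (setT \subset B) by rewrite subTset.
exists J; first exact/arises_from_J/setD_sub_J/sub_LR_union.
exists [set L_class l | l in B], [set R_class r | r in [set r | ~~ blocked B r]].
split.
- by apply/set0Pn; exists (L_class b); rewrite imset_f.
- rewrite L_classesE properE imsetS ?subset_predT //; apply/subsetPn.
  exists (L_class c); first by rewrite imset_f.
  apply: contra NBc => /imsetP[l Bl e].
  by have := elt_L_class (inl ord0) c false l; rewrite -e elt_L_class eqxx => /esym/eqP->.
- apply/set0Pn; exists (R_class (inl c)); rewrite imset_f // inE.
  by apply: contra NBc => /exists_inP[k Bk /= /eqP<-].
- rewrite R_classesE properE imsetS ?subset_predT //; apply/subsetPn.
  exists (R_class (inl b)); first by rewrite imset_f.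
  apply/imsetP => -[r]; rewrite inE => Nr e.
  have := elt_R_class (inl b) ord0 false r; rewrite -e elt_R_class eqxx => /esym/eqP er.
  by case/negP: Nr; rewrite -er; apply/exists_inP; exists b => /=.
apply: setIJ_eq => [|r l s].
  by rewrite subUset !cover_imset_sub // => ?; rewrite ?L_class_sub ?R_class_sub.
by rewrite elt_LR_union in_setU elt_cover_L elt_cover_R inE.
Qed.

Lemma type_M4_R_complement r : 0 < m -> type_M4 S (R_complement r).
Proof.
move=> m_gt0; exists J; first exact/arises_from_J/setD_sub_J/sub_R_complement.
pose P := [set r' | (r' != r) && (r' != rev_index r)].
exists [set R_class r' | r' in P]; first by rewrite R_classesE imsetS ?subset_predT.
split.
  apply: setIJ_eq => [|r' l s]; last by rewrite elt_R_complement elt_cover_R inE.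
  by rewrite cover_imset_sub // => ?; rewrite R_class_sub.
have [r' /andP[ner ner']] : exists r', (r' != r) && (r' != rev_index r).
  by case: r {P} => i; [exists (inr (Ordinal m_gt0)) | exists (inl ord0)].
apply/set0Pn; exists (elt r' ord0 false).
by rewrite in_setI elt_J elt_R_complement ner ner'.
Qed.

Lemma gamma_R_class r : [set gamma * a | a in R_class r] = R_class (rev_index r).
Proof.
apply/setP => a; apply/imsetP/R_classP => [[_ /R_classP[l [s ->]] ->] | [l [s ->]]].
  by exists l, (~~ s); rewrite gamma_elt.
exists (elt r l (~~ s)); last by rewrite gamma_elt negbK.
by rewrite elt_R_class.
Qed.

End Types.

(** * Description by points of the chain, and enumeration *)

Section Indices.

Variable m : nat.

Local Notation S := (POD m.+1).
Local Notation J := (Jrank m.+1 :&: POD m.+1).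

Implicit Types (r : kernel_index m) (l : 'I_m.+1) (A B : {set 'I_m.+1}).
Implicit Types (a b : PT m.+1) (X Y M : {set PT m.+1}).

Lemma elt_Lmiss r l s i : (elt r l s \in Lmiss i) = (l == i).
Proof. by rewrite in_set elt_Jrank im_elt in_setC1 negbK eq_sym. Qed.

Lemma elt_Rmiss r l s (i : 'I_m.+1) : (elt r l s \in Rmiss i) = (r == inl i).
Proof. by rewrite in_set elt_Jrank dom_elt. Qed.

Lemma elt_Rker r l s (i j : 'I_m.+1) (k : 'I_m) : i = k :> nat -> j = k.+1 :> nat ->
  (elt r l s \in Rker i j) = (r == inr k).
Proof.
move=> ei ej; rewrite in_set elt_Jrank ker_elt ?ei ?ej //=.
case: r => k'; first by [].
by rewrite eqSS andbb eq_sym.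
Qed.

Lemma elt_Lpair r l s i : (elt r l s \in Lpair i) = (l == i) || (l == rev_ord i).
Proof. by rewrite in_setU !elt_Lmiss. Qed.

Lemma elt_Rpair r l s (i : 'I_m.+1) :
  (elt r l s \in Rpair i) = (r == inl i) || (r == rev_index (inl i)).
Proof. by rewrite in_setU !elt_Rmiss. Qed.

Lemma elt_Kpair r l s (i j : 'I_m.+1) (k : 'I_m) : i = k :> nat -> j = k.+1 :> nat ->
  (elt r l s \in Kpair i j) = (r == inr k) || (r == rev_index (inr k)).
Proof.
move=> ei ej; rewrite in_setU (elt_Rker _ _ _ ei ej).
rewrite (@elt_Rker _ _ _ _ _ (rev_ord k)) //= ?ei ?ej; have := ltn_ord k; lia.
Qed.

(** Two subsets of S that contain all elements whose rank is not m are equal if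
they have the same elements of rank m. *)
Lemma POD_subset_eq X Y : X \subset S -> Y \subset S ->
    S :\: Jrank m.+1 \subset X -> S :\: Jrank m.+1 \subset Y ->
    (forall r l s, (elt r l s \in X) = (elt r l s \in Y)) ->
  X = Y.
Proof.
move=> sXS sYS sIX sIY eXY; apply/setP => a.
have [aS | NaS] := boolP (a \in S); last first.
  by rewrite !(contraNF (subsetP _ a) NaS).
have [aJ | NaJ] := boolP (a \in Jrank m.+1).
  by have /eltP[r [l [s ->]]] : a \in J by apply/setIP.
by rewrite (subsetP sIX) ?(subsetP sIY) // in_setD NaJ.
Qed.

Lemma Rpair_Jrank (i : 'I_m.+1) : Rpair i \subset Jrank m.+1.
Proof.
by rewrite subUset; apply/andP; split; apply/subsetP => a; rewrite in_set => /andP[].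
Qed.

Lemma Kpair_Jrank (i j : 'I_m.+1) : Kpair i j \subset Jrank m.+1.
Proof.
by rewrite subUset; apply/andP; split; apply/subsetP => a; rewrite in_set => /andP[].
Qed.

Lemma R_complement_Rpair (i : 'I_m.+1) : S :\: Rpair i = R_complement (inl i).
Proof.
apply: POD_subset_eq; rewrite ?subsetDl ?sub_R_complement ?setDS ?Rpair_Jrank //.
by move=> r l s; rewrite in_setD elt_POD elt_Rpair elt_R_complement negb_or andbT.
Qed.

Lemma R_complement_Kpair (i j : 'I_m.+1) (k : 'I_m) : i = k :> nat -> j = k.+1 :> nat ->
  S :\: Kpair i j = R_complement (inr k).
Proof.
move=> ei ej; apply: POD_subset_eq; rewrite ?subsetDl ?sub_R_complement ?setDS ?Kpair_Jrank //.
by move=> r l s; rewrite in_setD elt_POD (elt_Kpair _ _ _ ei ej) elt_R_complement negb_or andbT.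
Qed.

(** A choice of representatives for the orbits of the reflection on kernel
indices. *)
Definition lower_index r :=
  match r with inl i => i < uphalf m.+1 | inr i => i < m.+1./2 end.

Lemma lower_index_or r : lower_index r || lower_index (rev_index r).
Proof. by case: r => i /=; have := ltn_ord i; lia. Qed.

Lemma lower_index_rev r : lower_index r -> lower_index (rev_index r) -> rev_index r = r.
Proof.
by case: r => i /= lt1 lt2; congr (_ _); apply/val_inj => /=; have := ltn_ord i; lia.
Qed.

Lemma R_complement_lower r :
  exists2 r', lower_index r' & R_complement r = R_complement r'.
Proof.
case/orP: (lower_index_or r) => lo; first by exists r.
by exists (rev_index r); rewrite ?R_complement_rev.
Qed.

(** The closure of A under the reflection. *)
Definition symmetrize A := [set l | (l \in A) || (rev_ord l \in A)].

Lemma symmetrize_rev_closed A : rev_closed (symmetrize A).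
Proof. by apply/forall_inP => l; rewrite !inE rev_ordK orbC. Qed.

Lemma symmetrizeK A : A \subset lower_half m.+1 ->
  symmetrize A :&: lower_half m.+1 = A.
Proof.
move=> /subsetP sA; apply/setP => l; rewrite !inE.
apply/andP/idP => [[/orP[// | Arl] ltl] | Al]; last by rewrite Al; have := sA l Al; rewrite inE.
have := sA _ Arl; rewrite inE /= => ltrl.
by have <- : rev_ord l = l by apply/val_inj => /=; lia.
Qed.

Lemma lower_halfK B : rev_closed B -> symmetrize (B :&: lower_half m.+1) = B.
Proof.
move=> /rev_closedP revB; apply/setP => l; rewrite !inE revB -andb_orr.
suff -> : (l < uphalf m.+1) || (rev_ord l < uphalf m.+1) by rewrite andbT.
by have := lower_index_or (inl l).
Qed.

(** The points of A and their reflections are the images allowed in the union.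
A kernel is unblocked if and only if the representative of its orbit meets the
condition given by A alone: for i < n / 2, the points i and i + 1 are not
reflections of points of A outside {i, i + 1}. *)
Lemma POD_ofE A : A \subset lower_half m.+1 -> POD_of A = LR_union (symmetrize A).
Proof.
move=> /subsetP sA; apply: POD_subset_eq; rewrite ?LR_union_sub ?sub_LR_union ?subsetUl //.
  rewrite subUset subsetDl /=; apply/subsetP => a /setUP[/setUP[]|].
  - by case/bigcupP => i _ /setIP[].
  - by case/bigcupP => i _ /setIP[].
  - by case/bigcupP => i _ /bigcupP[j _ /setIP[]].
move=> r l s; rewrite elt_LR_union in_setU in_setD elt_Jrank /=.
rewrite !in_setU -orbA; congr (_ || _).
  apply/bigcupP/idP => [[i Ai /setIP[]] | ].
    by rewrite elt_Lpair => /orP[]/eqP-> _; rewrite inE ?rev_ordK Ai ?orbT.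
  rewrite inE => /orP[] Al; [exists l | exists (rev_ord l)] => //;
  by rewrite in_setI elt_POD elt_Lpair ?rev_ordK eqxx ?orbT.
have loA i : i \in A -> i < uphalf m.+1 by move/sA; rewrite inE.
apply/orP/idP => [[] | Nblocked].
- case/bigcupP => i /andP[]; rewrite inE => loi NAi /setIP[]; rewrite elt_Rpair => ri _.
  have NB : ~~ blocked (symmetrize A) (inl i).
    apply/exists_inP => -[k]; rewrite inE => /orP Ak /= /eqP ek; subst k.
    case: Ak => [Ai | Ari]; first by case/negP: NAi.
    have := loA _ Ari => /= lori; case/negP: NAi.
    by have <- : rev_ord i = i by apply/val_inj => /=; lia.
  by case/orP: ri => /eqP->; rewrite ?blocked_rev // symmetrize_rev_closed.
- case/bigcupP => i loi /bigcupP[j /and3P[/eqP ej NAi NAj] /setIP[]].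
  have ltim : i < m by have := ltn_ord j; lia.
  rewrite (@elt_Kpair _ _ _ _ _ (Ordinal ltim)) // => ri _.
  have NB : ~~ blocked (symmetrize A) (inr (Ordinal ltim)).
    apply/exists_inP => -[k]; rewrite inE => Ak /= /orP ek.
    have NAij (k' : 'I_m.+1) : k' \in A -> k' = i :> nat \/ k' = j :> nat -> False.
      by move=> Ak' [] /val_inj e; [case/negP: NAi | case/negP: NAj]; rewrite -e.
    case/orP: Ak => [/NAij | Ark]; first by apply; case: ek => /eqP->; auto.
    have := loA _ Ark; apply/negP; rewrite -leqNgt leqNgt; apply/negP => lork.
    apply: NAij Ark _; move: lork ek => /=; lia.
  by case/orP: ri => /eqP->; rewrite ?blocked_rev // symmetrize_rev_closed.
have [r' [lor' NB er]] : exists r', [/\ lower_index r',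
    ~~ blocked (symmetrize A) r' & (r == r') || (r == rev_index r')].
  case/orP: (lower_index_or r) => lo; first by exists r; rewrite eqxx.
  exists (rev_index r); rewrite rev_indexK eqxx orbT.
  by rewrite blocked_rev ?symmetrize_rev_closed.
case: r' lor' NB er => i /= loi NB er; [left | right].
  apply/bigcupP; exists i; last by rewrite in_setI elt_POD elt_Rpair er.
  rewrite inE loi; apply: contra NB => Ai.
  by apply/exists_inP; exists i; rewrite ?inE ?Ai /=.
apply/bigcupP; exists (lift ord_max i); first by rewrite lift_max.
apply/bigcupP; exists (lift ord0 i).
  rewrite lift0 lift_max eqxx /=; apply/andP; split; apply: contra NB => Ai; apply/exists_inP.
    by exists (lift ord_max i); rewrite ?inE ?Ai //= /bump; have := ltn_ord i; lia.
  by exists (lift ord0 i); rewrite ?inE ?Ai //= /bump; lia.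
by rewrite in_setI elt_POD (@elt_Kpair _ _ _ _ _ i) ?lift_max ?lift0 // er.
Qed.

Lemma symmetrize_neq0 A : A != set0 -> symmetrize A != set0.
Proof. by case/set0Pn => i Ai; apply/set0Pn; exists i; rewrite inE Ai. Qed.

Lemma symmetrize_neqT A : A \proper lower_half m.+1 -> symmetrize A != setT.
Proof.
move=> /properP[sA [i loi NAi]]; apply: contraNneq NAi => AT.
by rewrite -(symmetrizeK sA) AT setTI.
Qed.

Lemma LR_union_POD_of M :
  (exists B, [/\ B != set0, B != setT, rev_closed B & M = LR_union B]) <->
  (exists A, [/\ A != set0, A \proper lower_half m.+1 & M = POD_of A]).
Proof.
split=> [[B [B0 BT revB ->]] | [A [A0 pA ->]]].
  have sB : B :&: lower_half m.+1 \subset lower_half m.+1 by exact: subsetIr.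
  exists (B :&: lower_half m.+1); split; last by rewrite POD_ofE ?lower_halfK.
    apply: contraNneq B0 => B0; rewrite -(lower_halfK revB) B0.
    by apply/eqP/setP => l; rewrite !inE.
  rewrite properEneq sB andbT; apply: contraNneq BT => BT; rewrite -(lower_halfK revB) BT.
  apply/eqP/setP => l; rewrite !inE.
  by have := lower_index_or (inl l).
exists (symmetrize A); rewrite symmetrize_neq0 ?symmetrize_neqT ?symmetrize_rev_closed //.
by split=> //; rewrite POD_ofE ?proper_sub.
Qed.

Lemma R_complement_classes M :
  (exists2 R : {set PT m.+1}, R \in classes_in (@greenR (PT m.+1)) S J &
     M = S :\: (R :|: [set gamma m.+1 * r | r in R])) <->
  (exists r, M = R_complement r).
Proof.
rewrite R_classesE //; split=> [[_ /imsetP[r _ ->] ->] | [r ->]].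
  by exists r; rewrite gamma_R_class.
by exists (R_class r); rewrite ?gamma_R_class ?imset_f.
Qed.

Lemma R_complement_pairs M :
  (exists r, M = R_complement r) <->
  (exists2 i : 'I_m.+1, i < uphalf m.+1 & M = S :\: Rpair i) \/
  (exists i j : 'I_m.+1, [/\ i < m.+1./2, j = i.+1 :> nat & M = S :\: Kpair i j]).
Proof.
split=> [[r ->] | [[i _ ->] | [i [j [loi ej ->]]]]].
- have [[i | i] loi ->] := R_complement_lower r; [left | right].
    by exists i; rewrite ?R_complement_Rpair.
  exists (lift ord_max i), (lift ord0 i); rewrite lift_max lift0; split=> //.
  by rewrite (@R_complement_Kpair _ _ i) ?lift_max ?lift0.
- by exists (inl i); rewrite R_complement_Rpair.
- have ltim : i < m by have := ltn_ord j; lia.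
  by exists (inr (Ordinal ltim)); rewrite (@R_complement_Kpair _ _ (Ordinal ltim)).
Qed.

Lemma card_ord_lt n k : k <= n -> #|[set i : 'I_n | i < k]| = k.
Proof.
move=> lekn; have widen_inj : injective (widen_ord lekn).
  by move=> i j /(congr1 val) /= /val_inj.
rewrite -[RHS]card_ord -cardsT -(card_imset _ widen_inj).
apply: eq_card => i; rewrite inE; apply/idP/imsetP => [ltik | [j _ ->]] /=.
  by exists (Ordinal ltik); [rewrite inE | apply/val_inj].
exact: ltn_ord.
Qed.

Lemma card_lower_index : #|[set r | lower_index r]| = m.+1.
Proof.
have inlI : injective (@inl 'I_m.+1 'I_m) by move=> ? ? [].
have inrI : injective (@inr 'I_m.+1 'I_m) by move=> ? ? [].
have -> : [set r | lower_index r] =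
    inl @: [set i : 'I_m.+1 | i < uphalf m.+1] :|: inr @: [set i : 'I_m | i < m.+1./2].
  apply/setP => -[] i; rewrite !inE.
    rewrite (mem_imset _ _ inlI) inE orbC; case: imsetP => // -[] //.
  rewrite (mem_imset _ _ inrI) inE; case: imsetP => // -[] //.
rewrite cardsU (_ : _ :&: _ = set0) ?cards0 ?subn0; last first.
  apply/setP => r; rewrite in_setI in_set0.
  by apply/andP => -[/imsetP[i _ ->] /imsetP[j _]].
rewrite !card_imset ?card_ord_lt; try lia; move=> ? ? [] //.
Qed.

(** The sets A that index the maximal subsemigroups of type (M2). *)
Definition orbit_subsets :=
  [set A : {set 'I_m.+1} | (A != set0) && (A \proper lower_half m.+1)].

Lemma card_orbit_subsets : #|orbit_subsets| = (2 ^ uphalf m.+1 - 2)%N.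
Proof.
have -> : orbit_subsets = powerset (lower_half m.+1) :\ set0 :\ lower_half m.+1.
  apply/setP => A; rewrite !inE properEneq; case: (A != _) => //=.
  by rewrite andbF.
have := cardsD1 set0 (powerset (lower_half m.+1)).
have := cardsD1 (lower_half m.+1) (powerset (lower_half m.+1) :\ set0).
rewrite card_powerset card_ord_lt; last by lia.
rewrite !inE sub0set subxx /= (_ : lower_half m.+1 != set0) /=; first by lia.
by apply/set0Pn; exists ord0; rewrite inE.
Qed.

Lemma card_maximal_subsemigroups : 0 < m ->
  #|[set M | maximal_subsemigroup S M]| = (2 ^ uphalf m.+1 + m.+1 - 1)%N.
Proof.
move=> m_gt0; pose LR := @POD_of m.+1 @: orbit_subsets.
pose RR := @R_complement m @: [set r | lower_index r].
have mem_LR M : reflect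
    (exists B, [/\ B != set0, B != setT, rev_closed B & M = LR_union B]) (M \in LR).
  apply: (iffP imsetP) => [[A + ->] | /LR_union_POD_of[A [A0 pA ->]]].
    by rewrite inE => /andP[A0 pA]; apply/LR_union_POD_of; exists A.
  by exists A; rewrite // inE A0.
have mem_RR M : reflect (exists r, M = R_complement r) (M \in RR).
  apply: (iffP imsetP) => [[r _ ->] | [r ->]]; first by exists r.
  by have [r' lo ->] := R_complement_lower r; exists r'; rewrite ?inE.
have -> : [set M | maximal_subsemigroup S M] = (S :\ gamma m.+1) |: (LR :|: RR).
  apply/setP => M; rewrite in_set in_setU1 in_setU.
  apply/idP/or3P => [/(maximal_candidate _ m_gt0)[->|/mem_LR|/mem_RR] | ].
  - by rewrite eqxx; constructor 1.
  - by constructor 2.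
  - by constructor 3.
  by move=> h; apply/(maximal_candidate _ m_gt0); case: h => [/eqP|/mem_LR|/mem_RR];
    [constructor 1 | constructor 2 | constructor 3].
have LR_RR0 : LR :&: RR = set0.
  apply/setP => M; rewrite in_setI in_set0.
  apply/andP => -[/mem_LR[B [B0 _ _ ->]] /mem_RR[r e]].
  by case/negP: (LR_union_notsub_R_complement r B0); rewrite e.
rewrite cardsU1 in_setU.
have -> : S :\ gamma m.+1 \in LR = false.
  apply/mem_LR => -[B [_ _ _ e]]; have := gamma_LR_union B.
  by rewrite -e in_setD1 eqxx.
have -> : S :\ gamma m.+1 \in RR = false.
  apply/mem_RR => -[r e]; have := gamma_R_complement r.
  by rewrite -e in_setD1 eqxx.
rewrite cardsU LR_RR0 cards0 subn0 !card_in_imset ?card_orbit_subsets ?card_lower_index.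
- have : (2 <= 2 ^ uphalf m.+1)%N by rewrite (leq_exp2l 1).
  by move: (2 ^ uphalf m.+1)%N => N; rewrite add1n; lia.
- move=> r r'; rewrite !inE => lo lo' e.
  have : R_complement r \subset R_complement r' by rewrite e.
  case/R_complement_subset => // er; rewrite er; apply: lower_index_rev => //.
  by rewrite -er.
move=> A A'; rewrite !inE => /andP[A0 pA] /andP[A0' pA'].
rewrite !POD_ofE ?proper_sub // => e.
rewrite -(symmetrizeK (proper_sub pA)) -(symmetrizeK (proper_sub pA')).
congr (_ :&: _); apply: LR_union_subset_eq; rewrite ?symmetrize_neq0 ?symmetrize_neqT //.
by rewrite e.
Qed.

End Indices.

(** * The case n = 1 *)

Section RankOne.

(** The nowhere defined map; with 1 it makes up the monoid for n = 1. *)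
Definition empty_map : PT 1 := [ffun => None].

Lemma PT1_cases (a : PT 1) : a = 1 \/ a = empty_map.
Proof.
case a0: (a ord0) => [x|]; [left | right]; apply/ffunP => i;
  by rewrite !ffunE (ord1 i) a0 ?(ord1 x).
Qed.

Lemma empty_map_neq1 : empty_map != 1.
Proof. by apply/eqP => /ffunP/(_ ord0); rewrite !ffunE. Qed.

Lemma POD1_setT : POD 1 = [set: PT 1].
Proof.
apply/setP => a; rewrite !inE; apply/orP; left.
by apply/order_preservingP => i j x y _ _ _; rewrite (ord1 x).
Qed.

Lemma PT1_idempotent (a : PT 1) : a * a = a.
Proof.
case: (PT1_cases a) => ->; first exact: mulg1.
by apply/ffunP => i; rewrite !ffunE.
Qed.

Lemma PT1_commute (a b : PT 1) : a * b = b * a.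
Proof.
case: (PT1_cases a) => ->; first by rewrite mulg1 mul1g.
by case: (PT1_cases b) => ->; rewrite ?mulg1 ?mul1g.
Qed.

Lemma card_POD1 : #|POD 1| = 2.
Proof.
rewrite POD1_setT (_ : [set: PT 1] = [set empty_map; 1]).
  by rewrite cards2 empty_map_neq1.
by apply/setP => a; rewrite !inE; case: (PT1_cases a) => ->; rewrite eqxx ?orbT.
Qed.

Lemma semilattice_POD1 : semilattice (POD 1).
Proof.
rewrite POD1_setT; split=> [|a b _ _|a _]; last exact: PT1_idempotent.
  apply/subsemigroupP; split; first by apply/set0Pn; exists 1; rewrite inE.
  by move=> a b _ _; rewrite inE.
exact: PT1_commute.
Qed.

Lemma maximal_POD1 (M : {set PT 1}) : maximal_subsemigroup (POD 1) M <->
  exists2 a : PT 1, a \in POD 1 & M = [set a].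
Proof.
have card1 (X : {set PT 1}) : X != set0 -> X \proper POD 1 -> #|X| = 1%N.
  by rewrite -card_gt0 => X0 /proper_card; rewrite card_POD1; lia.
split=> [/maxsetP[/andP[sgM pM] _] | [a _ ->]].
  have /subsemigroupP[M0 _] := sgM; have /eqP/cards1P[a ->] := card1 M M0 pM.
  by exists a; rewrite // POD1_setT inE.
have sg : subsemigroup [set a].
  apply/subsemigroupP; split; first by apply/set0Pn; exists a; rewrite inE.
  by move=> b c /set1P-> /set1P->; rewrite PT1_idempotent inE.
have pa : [set a] \proper POD 1.
  by rewrite properEcard POD1_setT subsetT -POD1_setT card_POD1 cards1.
apply/maxsetP; rewrite sg pa; split=> // X /andP[/subsemigroupP[X0 _] pX] saX.
by apply/esym/eqP; rewrite eqEcard saX (card1 X) ?cards1.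
Qed.

Lemma card_maximal_POD1 : #|[set M : {set PT 1} | maximal_subsemigroup (POD 1) M]| = 2.
Proof.
rewrite -card_POD1 -(card_imset _ (@set1_inj (PT 1))); apply: eq_card => M.
rewrite in_set; apply/idP/imsetP => [/maximal_POD1[a aS ->] | [a aS ->]].
  by exists a.
by apply/maximal_POD1; exists a.
Qed.

End RankOne.

(** * The maximal subsemigroups and their number *)

Theorem theorem3p3 :
  [/\ (forall n : nat, 2 <= n ->
        [/\ (forall M : {set PT n},
               maximal_subsemigroup (POD n) M <->
               [\/ M = POD n :\ gamma n,
                   (exists A : {set 'I_n},
                      [/\ A != set0, A \proper lower_half n & M = POD_of A])
                 | (exists2 R : {set PT n},
                      R \in classes_in (@greenR (PT n)) (POD n) (Jrank n :&: POD n) &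
                      M = POD n :\: (R :|: [set gamma n * r | r in R]))]),
            type_M5 (POD n) (POD n :\ gamma n),
            (forall A : {set 'I_n}, A != set0 -> A \proper lower_half n ->
               type_M2 (POD n) (POD_of A)),
            (forall R : {set PT n},
               R \in classes_in (@greenR (PT n)) (POD n) (Jrank n :&: POD n) ->
               type_M4 (POD n) (POD n :\: (R :|: [set gamma n * r | r in R])))
          & (forall M : {set PT n},
               (exists2 R : {set PT n},
                  R \in classes_in (@greenR (PT n)) (POD n) (Jrank n :&: POD n) &
                  M = POD n :\: (R :|: [set gamma n * r | r in R])) <->
               (exists2 i : 'I_n, i < uphalf n & M = POD n :\: Rpair i) \/
               (exists i j : 'I_n,
                  [/\ i < n./2, j = i.+1 :> nat & M = POD n :\: Kpair i j]))]),
      [/\ POD 1 = [set: PT 1], semilattice (POD 1), #|POD 1| = 2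
        & forall M : {set PT 1},
            maximal_subsemigroup (POD 1) M <->
            exists2 a : PT 1, a \in POD 1 & M = [set a]]
    & forall n : nat, 1 <= n ->
        #|[set M : {set PT n} | maximal_subsemigroup (POD n) M]|
        = (2 ^ uphalf n + n - 1)%N].
Proof.
split.
- case=> [|m] //; rewrite ltnS => m_gt0; split.
  + move=> M; have [toC ofC] := maximal_candidate M m_gt0.
    split=> [/toC[->|/LR_union_POD_of|/R_complement_classes] | h]; first by constructor 1.
    * by constructor 2.
    * by constructor 3.
    apply: ofC; case: h => [->|/LR_union_POD_of|/R_complement_classes];
      by [constructor 1 | constructor 2 | constructor 3].
  + exact: type_M5_POD_gamma.
  + move=> A A0 pA; rewrite POD_ofE ?proper_sub //.
    by apply: type_M2_LR_union; rewrite ?symmetrize_neq0 ?symmetrize_neqT.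
  + rewrite R_classesE // => _ /imsetP[r _ ->]; rewrite gamma_R_class.
    exact: type_M4_R_complement.
  + move=> M; apply: iff_trans (R_complement_classes M) _.
    exact: R_complement_pairs.
- split; [exact: POD1_setT | exact: semilattice_POD1 | exact: card_POD1 |].
  exact: maximal_POD1.
case=> [|[|m]] // _; first exact: card_maximal_POD1.
exact: card_maximal_subsemigroups.
Qed.
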